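(* (i) Exact identification of Boolean functions of $n$ variables that are read-once over the basis $\mathcal M$ of all monotone threshold functions, using membership and subcube identity queries, requires a number of queries exponential in $n$ in the worst case. (ii) For every finite subset $\mathcal B\subseteq\mathcal M$ there is a polynomial $P$ such that Boolean functions of $n$ variables read-once over $\mathcal B$ can be exactly identified with at most $P(n)$ membership and subcube identity queries.
   Context: A threshold function is a Boolean function $f(x_1,\ldots,x_m)$ with $f(x)=1\iff\alpha_1x_1+\cdots+\alpha_mx_m\ge\alpha_0$ for some reals $\alpha_i$; it is monotone threshold if this holds with $\alpha_1,\ldots,\alpha_m\ge0$. A formula over a basis $\mathcal B$ is read-once if every variable occurs in it exactly once; a Boolean function of $X=\{x_1,\ldots,x_n\}$ is read-once over $\mathcal B$ if it is expressible by such a formula (other variables of $X$ are fictitious). A partial assignment $p$ is a map $X\to\{0,1,*\}$; the projection $f_p$ is the function of $p^{-1}( * )$ obtained by fixing the other variables to their values under $p$. A membership query takes a total assignment $a$ and returns $f(a)$; a subcube identity query takes a partial assignment $p$ and returns ''yes'' iff $f_p\equiv0$ or $f_p\equiv1$. Exact identification: a deterministic algorithm, knowing the basis and $X$, adaptively queries the unknown target from the class and must determine it; complexity is the worst-case number of queries, as a function of $n$. *)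

(* Defs.v *)
From mathcomp Require Import all_boot all_order all_algebra.
From mathcomp Require Import boolp classical_sets cardinality reals.

Set Implicit Arguments.
Unset Strict Implicit.
Unset Printing Implicit Defensive.

Import Order.TTheory GRing.Theory Num.Theory.
Local Open Scope classical_set_scope.
Local Open Scope ring_scope.

Definition assignment (V : finType) := {ffun V -> bool}.
Definition bfun (V : finType) := {ffun assignment V -> bool}.

(* A basis is a set of gates of arbitrary arities; arity 0 is allowed, and
   a gate may have fictitious arguments. *)
Definition gate := {m : nat & bfun 'I_m}.

Definition monotone_threshold (R : realType) (m : nat) (f : bfun 'I_m) : Prop :=
  exists (alpha0 : R) (alpha : 'I_m -> R), (forall i, 0 <= alpha i) /\
    forall x : assignment 'I_m,
      f x = (alpha0 <= \sum_(i < m) alpha i * (x i)%:R).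

Definition monotone_threshold_basis (R : realType) : set gate :=
  [set g | monotone_threshold R (projT2 g)].

Section Formulas.
Variable V : finType.

Inductive formula : Type :=
| Var of V
| App (g : gate) of ('I_(projT1 g) -> formula).

Fixpoint formula_over (B : set gate) (F : formula) : Prop :=
  match F with
  | Var _ => True
  | App g args => B g /\ forall i, formula_over B (args i)
  end.

Fixpoint eval (F : formula) (x : assignment V) : bool :=
  match F with
  | Var v => x v
  | App g args => projT2 g [ffun i => eval (args i) x]
  end.

Fixpoint occurrences (v : V) (F : formula) : nat :=
  match F with
  | Var w => v == w
  | App g args => (\sum_(i < projT1 g) occurrences v (args i))%N
  end.

(* Variables of V that do not occur in F are fictitious for the function
   it expresses, hence "at most once". *)
Definition read_once_formula (F : formula) : Prop :=
  forall v, (occurrences v F <= 1)%N.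

Definition read_once (B : set gate) : set (bfun V) :=
  [set f | exists F, [/\ formula_over B F, read_once_formula F &
                         forall x, f x = eval F x]].

End Formulas.

Section Queries.
Variable V : finType.

(* None encodes the symbol *. *)
Definition partial_assignment := {ffun V -> option bool}.

Definition free_var (p : partial_assignment) : finType := {v : V | p v == None}.

(* insub v is Some u exactly when p leaves v free. *)
Definition fill (p : partial_assignment) (y : assignment (free_var p)) :
    assignment V :=
  [ffun v => if insub v is Some u then y u else p v == Some true].

Definition projection (f : bfun V) (p : partial_assignment) :
    bfun (free_var p) :=
  [ffun y => f (fill y)].

Inductive query : Type :=
| Membership of assignment V
| SubcubeIdentity of partial_assignment.

Definition answer (f : bfun V) (q : query) : bool :=
  match q with
  | Membership a => f a
  | SubcubeIdentity p =>
      [forall y, projection f p y == false] || [forall y, projection f p y == true]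
  end.

(* A deterministic adaptive algorithm for a fixed set of variables, as a
   decision tree: Ask q no yes queries q and continues according to the answer,
   Output f stops and claims that the target is f. *)
Inductive algorithm : Type :=
| Output of bfun V
| Ask of query & algorithm & algorithm.

Fixpoint run (A : algorithm) (f : bfun V) : bfun V :=
  match A with
  | Output h => h
  | Ask q no yes => run (if answer f q then yes else no) f
  end.

Fixpoint queries_used (A : algorithm) (f : bfun V) : nat :=
  match A with
  | Output _ => 0
  | Ask q no yes => (queries_used (if answer f q then yes else no) f).+1
  end.

Definition exactly_identifies (A : algorithm) (C : set (bfun V)) : Prop :=
  forall f, C f -> run A f = f.

Definition worst_case_queries (A : algorithm) (C : set (bfun V)) : nat :=
  (\max_(f : bfun V | `[< C f >]) queries_used A f)%N.

End Queries.

Arguments read_once : clear implicits.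

(* Main.v *)
Require Import Defs.
From HB Require Import structures.
From mathcomp Require Import all_boot all_order all_algebra.
From mathcomp Require Import boolp classical_sets cardinality reals.
From mathcomp Require Import lra zify.

(* (i) With k = n/2, let h be [|x| > k] and, for every k-set S, let f_S be
   [|x| > k or x = S]; all are monotone threshold functions. A query separates
   h from at most two of the f_S, so 2q >= C(n, k).

   (ii) Enlarge the class to read-once compositions of monotone threshold
   functions of arity at most l, constants included, which is closed under
   projections. Keep a set S of variables, a partial assignment p such that
   phi = f_p is known and depends on all of S, and a polynomial set T of points
   determining phi within the class. Change p outside S towards all 0 and towards
   all 1, one variable at a time, comparing the projection with phi on T. If it
   never changes then f = phi by monotonicity. Otherwise some variable v with
   value c, when flipped, makes the projection psi to S + v an extension of phi
   that depends on v, and it remains to identify psi.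
   Write psi = Phi(g(v, G_1, ..., G_m), rest) with disjoint blocks of variables,
   g of bounded arity, and m minimal. Every set A of l+1 variables of phi is
   jointly essential in some subcube p_A (this fails for general monotone gates,
   and is where thresholds are used). The values of psi on the subcubes p_A, with v
   free, reveal the block of each variable relative to representatives of the
   blocks, so that psi is determined by these values, g and the representatives:
   polynomially many candidates remain, and they are separated pairwise. *)

Set Implicit Arguments.
Unset Strict Implicit.
Unset Printing Implicit Defensive.

Import Order.TTheory GRing.Theory Num.Theory.

(** * Essential variables and projections *)

Section Dependence.
Variable T : finType.
Implicit Types (x y p : {ffun T -> bool}) (f : {ffun T -> bool} -> bool).
Implicit Types (A : {set T}) (a w : T) (s : bool).

Definition upd x a s : {ffun T -> bool} := [ffun w => if w == a then s else x w].

Definition cst s : {ffun T -> bool} := [ffun=> s].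

Definition dep f a := [exists x, f (upd x a false) != f (upd x a true)].

Definition mono f := forall x y, (forall a, x a -> y a) -> f x -> f y.

Lemma updE x a s w : upd x a s w = if w == a then s else x w.
Proof. exact: ffunE. Qed.

Lemma upd_id x a : upd x a (x a) = x.
Proof. by apply/ffunP => w; rewrite ffunE; case: eqP => // ->. Qed.

Lemma upd_upd x a s s' : upd (upd x a s) a s' = upd x a s'.
Proof. by apply/ffunP => w; rewrite !ffunE; case: eqP. Qed.

Lemma updC x a a' s s' : a != a' -> upd (upd x a s) a' s' = upd (upd x a' s') a s.
Proof.
move=> naa'; apply/ffunP => w; rewrite !ffunE; case: (w =P a) => // ->.
by rewrite (negbTE naa').
Qed.

Lemma upd_eq x a s : upd x a s a = s. Proof. by rewrite ffunE eqxx. Qed.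

Lemma upd_neq x a w s : w != a -> upd x a s w = x w.
Proof. by rewrite ffunE => /negbTE ->. Qed.

Lemma depI f a x s s' : f (upd x a s) != f (upd x a s') -> dep f a.
Proof.
by case: s s' => -[]; rewrite ?eqxx // => h; apply/existsP; exists x; rewrite // eq_sym.
Qed.

Lemma indep f a x s : ~~ dep f a -> f (upd x a s) = f x.
Proof.
move=> nd; apply/eqP; apply/negPn; apply: contra nd; rewrite -{2}(upd_id x a).
exact: depI.
Qed.

Lemma eq_dep f x y : (forall a, dep f a -> x a = y a) -> f x = f y.
Proof.
move=> eqxy; pose z (r : seq T) : {ffun T -> bool} := [ffun w => if w \in r then y w else x w].
suff zE (r : seq T) : f (z r) = f x.
  by rewrite -(zE (enum T)); congr f; apply/ffunP => w; rewrite ffunE mem_enum.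
elim: r => [|a r <-]; first by congr f; apply/ffunP => w; rewrite ffunE.
have -> : z (a :: r) = upd (z r) a (y a).
  by apply/ffunP => w; rewrite !ffunE inE; case: eqP => [->|].
have [da|/indep //] := boolP (dep f a).
have {2}-> : z r = upd (z r) a (z r a) by rewrite upd_id.
by rewrite [z r a]ffunE; case: ifP => // _; rewrite eqxy.
Qed.

Lemma dep_ext f f' a : f =1 f' -> dep f a = dep f' a.
Proof. by move=> e; apply: eq_existsb => x; rewrite !e. Qed.

Lemma mono_dep f a : mono f -> dep f a -> exists x, forall s, f (upd x a s) = s.
Proof.
move=> mf /existsP[x nx]; exists x => s.
have le01 : f (upd x a false) -> f (upd x a true).
  by apply: mf => w; rewrite !ffunE; case: eqP.
move: nx le01; case: s; case: (f (upd x a false)); case: (f (upd x a true)) => //.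
all: by move=> _ /(_ isT).
Qed.

Lemma mono_cst f : mono f ->
  (forall s, f (cst s) = s) \/ (forall x y, f x = f y).
Proof.
move=> mf.
have f0 x : f (cst false) -> f x by apply: mf => w; rewrite ffunE.
have f1 x : f x -> f (cst true) by apply: mf => w; rewrite [cst _ _]ffunE.
case E0: (f (cst false)); first by right=> x y; rewrite (f0 x E0) (f0 y E0).
case E1: (f (cst true)); first by left; case.
right=> x y; have fF z : f z = false by apply/negP => /f1; rewrite E1.
by rewrite (fF x) (fF y).
Qed.

Lemma mono_dep_cst f a s : mono f -> dep f a -> f (cst s) = s.
Proof.
move=> mf /existsP[x nx]; case: (mono_cst mf) => // e.
by rewrite (e _ (upd x a true)) eqxx in nx.
Qed.

Lemma cst_dep f : (forall s, f (cst s) = s) -> exists a, dep f a.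
Proof.
move=> fs; apply/existsP; apply: contraT; rewrite negb_exists => /forallP nd.
suff : f (cst true) = f (cst false) by rewrite !fs.
by apply: eq_dep => a; rewrite (negbTE (nd a)).
Qed.

Lemma const_indep f a : (forall x y, f x = f y) -> ~~ dep f a.
Proof. by move=> e; apply/existsPn => x; rewrite (e _ (upd x a true)) eqxx. Qed.

Definition mix A x p : {ffun T -> bool} := [ffun w => if w \in A then x w else p w].

Definition proj f A p x := f (mix A x p).

Definition ess f A p := [forall a in A, dep (proj f A p) a].

Lemma mixE A x p w : mix A x p w = if w \in A then x w else p w.
Proof. exact: ffunE. Qed.

Lemma mix_upd A x p a s :
  a \in A -> mix A (upd x a s) p = upd (mix A x p) a s.
Proof.
move=> aA; apply/ffunP => w; rewrite !ffunE.
by case: (w =P a) => [->|]; rewrite ?aA.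
Qed.

Lemma mix_updN A x p a s : a \notin A -> mix A (upd x a s) p = mix A x p.
Proof.
move=> aA; apply/ffunP => w; rewrite !ffunE.
by case: (w =P a) => [->|]; rewrite ?(negbTE aA).
Qed.

Lemma dep_proj f A p a : dep (proj f A p) a -> (a \in A) && dep f a.
Proof.
case/existsP => x; rewrite /proj; have [aA|aA] := boolP (a \in A).
  by rewrite !mix_upd // => /depI.
by rewrite !mix_updN // eqxx.
Qed.

Lemma mono_proj f A p : mono f -> mono (proj f A p).
Proof.
move=> mf x y xy; apply: mf => w; rewrite !ffunE; case: ifP => // _; exact: xy.
Qed.

End Dependence.

Arguments cst {T}.
Arguments mono_proj {T f} A p _.

Section Glue.
Variables (I V : finType).
Implicit Types (E : I -> {set V}) (Z : I -> {ffun V -> bool}).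

Definition glue E Z (x0 : {ffun V -> bool}) : {ffun V -> bool} :=
  [ffun w => if [pick i | w \in E i] is Some i then Z i w else x0 w].

Lemma glue_in E Z x0 i w : (forall j, w \in E j -> j = i) -> w \in E i ->
  glue E Z x0 w = Z i w.
Proof.
move=> u wE; rewrite ffunE; case: pickP => [j /u -> //|/(_ i)].
by rewrite wE.
Qed.

Lemma glue_out E Z x0 w : (forall j, w \notin E j) -> glue E Z x0 w = x0 w.
Proof.
by move=> u; rewrite ffunE; case: pickP => [j|//]; rewrite (negbTE (u j)).
Qed.

End Glue.

(** * Read-once compositions of threshold gates *)

Section ReadOnce.
Variables (R : realType) (l : nat) (V : finType).
Implicit Types (f : assignment V -> bool) (D A : {set V}) (p x : assignment V).

Definition thr (alpha0 : R) (alpha : 'I_l -> R) (y : assignment 'I_l) : bool :=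
  (alpha0 <= \sum_i alpha i * (y i)%:R)%R.

Inductive ro : {set V} -> (assignment V -> bool) -> Prop :=
| ro_const D f s : (forall x, f x = s) -> ro D f
| ro_var D f v : v \in D -> (forall x, f x = x v) -> ro D f
| ro_gate D f alpha0 alpha (E : 'I_l -> {set V}) (h : 'I_l -> assignment V -> bool) :
    (forall i, 0 <= alpha i)%R ->
    (forall i, ro (E i) (h i)) ->
    (forall i a, a \in E i -> a \in D) ->
    (forall i j a, a \in E i -> a \in E j -> i = j) ->
    (forall x, f x = thr alpha0 alpha [ffun i => h i x]) ->
    ro D f.

Lemma thr_mono alpha0 alpha :
  (forall i, 0 <= alpha i)%R -> mono (thr alpha0 alpha).
Proof.
move=> a0 x y xy /le_trans; apply; apply: ler_sum => i _.
rewrite ler_wpM2l // ler_nat; have := xy i.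
by case: (x i) => // ->.
Qed.

Lemma gate_dep f (h : 'I_l -> assignment V -> bool) (gt : assignment 'I_l -> bool) a :
  (forall x, f x = gt [ffun i => h i x]) -> dep f a -> exists i, dep (h i) a.
Proof.
move=> fE /existsP[x]; rewrite !fE => ne; apply/existsP; apply: contraNT ne.
rewrite negb_exists => /forallP nd; apply/eqP; congr gt; apply/ffunP => i.
by rewrite !ffunE !indep.
Qed.

Lemma ro_dep D f a : ro D f -> dep f a -> a \in D.
Proof.
move=> rf; elim: rf a => {D f} [D f s fE|D f v vD fE|D f a0 al E h _ _ IH ED _ fE] a.
- by apply: contraTT => _; apply: const_indep => x y; rewrite !fE.
- have [-> //|nav] := eqVneq a v.
  by case/existsP=> x; rewrite !fE !upd_neq ?eqxx // eq_sym.
- by case/(gate_dep fE) => i /IH /ED.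
Qed.

Lemma ro_mono D f : ro D f -> mono f.
Proof.
elim=> {D f} [D f s fE|D f v vD fE|D f a0 al E h al0 _ IH _ _ fE] x y xy.
- by rewrite !fE.
- by rewrite !fE; apply: xy.
- rewrite !fE; apply: thr_mono => // i; rewrite !ffunE; exact: IH.
Qed.

Lemma ro_proj D f A p : ro D f -> ro D (proj f A p).
Proof.
elim=> {D f} [D f s fE|D f v vD fE|D f a0 al E h al0 _ IH ED dE fE].
- by apply: (@ro_const _ _ s) => x; apply: fE.
- have [vA|vA] := boolP (v \in A).
    by apply: (@ro_var _ _ v) => // x; rewrite /proj fE ffunE vA.
  by apply: (@ro_const _ _ (p v)) => x; rewrite /proj fE ffunE (negbTE vA).
- apply: (ro_gate al0 IH ED dE) => x; rewrite /proj fE.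
  by congr thr; apply/ffunP => i; rewrite !ffunE.
Qed.

Lemma thr_exchange alpha0 alpha (y : assignment 'I_l) i j :
  (alpha j <= alpha i)%R -> i != j ->
  (forall s, thr alpha0 alpha (upd y j s) = s) ->
  forall s, thr alpha0 alpha (upd (upd y j (y i)) i s) = s.
Proof.
move=> le_ji nij tj s.
have sumE z : (\sum_k alpha k * (z k)%:R = alpha i * (z i)%:R +
    (alpha j * (z j)%:R + \sum_(k | (k != i) && (k != j)) alpha k * (z k)%:R))%R.
  by rewrite (bigD1 i) //= (bigD1 j) //= eq_sym.
move: (tj false) (tj true); rewrite /thr !sumE !ffunE !eqxx (negbTE nij).
rewrite eq_sym (negbTE nij).
pose S := (\sum_(k | (k != i) && (k != j)) alpha k * (y k)%:R)%R.
have SE z : (forall k, k != i -> k != j -> z k = y k) ->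
    (\sum_(k | (k != i) && (k != j)) alpha k * (z k)%:R)%R = S.
  by move=> zE; apply: eq_bigr => k /andP[ki kj]; rewrite zE.
rewrite !SE; try by move=> k ki kj; rewrite ?upd_neq.
move/negbT; rewrite -ltNge => lt1 le2.
case: s; case: (y i) lt1 le2 => /= lt1 le2; try (apply/negbTE; rewrite -ltNge).
all: lra.
Qed.

(* For a threshold gate, a point where an argument of minimal weight is pivotal
   makes every argument of larger weight pivotal after at most one exchange. *)
Lemma ro_sep D f A : ro D f -> (forall a, a \in A -> dep f a) -> exists p, ess f A p.
Proof.
move=> rf; elim: rf A => {D f} [D f s fE|D f v vD fE|D f al0 al E h ge0 rh IH ED dE fE] A Adep.
- exists (cst false); apply/forall_inP => a /Adep.
  by rewrite (negbTE (const_indep _ _)) // => x y; rewrite !fE.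
- exists (cst false); apply/forall_inP => a aA.
  have av : a = v.
    apply/eqP; apply: contraLR (Adep a aA) => nav.
    by apply/existsPn => x; rewrite !fE !upd_neq ?eqxx // eq_sym.
  apply: (@depI _ _ _ (cst false) false true).
  by rewrite /proj !fE !mix_upd // av !upd_eq.
pose Ai i := A :&: finset (dep (h i)).
have AiE i a : dep (h i) a -> (a \in Ai i) = (a \in A).
  by move=> da; rewrite !inE da andbT.
have depA a : a \in A -> exists2 i, dep (h i) a & a \in Ai i.
  move=> aA; have [i da] := gate_dep fE (Adep a aA).
  by exists i; rewrite ?AiE.
have inE_dep i a : dep (h i) a -> a \in E i by move/(ro_dep (rh i)).
have [/existsP[a0 a0A]|] := boolP [exists a, a \in A]; last first.
  rewrite negb_exists => /forallP A0; exists (cst false).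
  by apply/forall_inP => a aA; case/negP: (A0 a).
have [i0 _ a0i0] := depA a0 a0A.
have Ai0 : Ai i0 != finset.set0 by apply/set0Pn; exists a0.
case: (@arg_minP _ _ _ i0 (fun i => Ai i != finset.set0) al Ai0) => j /set0Pn[b bj] jmin.
have bA : b \in A by move: bj; rewrite !inE => /andP[].
have dbj : dep (h j) b by move: bj; rewrite !inE => /andP[].
have mf : mono f by apply: (ro_mono (ro_gate ge0 rh ED dE fE)).
have [x xP] := mono_dep mf (Adep b bA).
pose y : assignment 'I_l := [ffun i => h i x].
have yP s : thr al0 al (upd y j s) = s.
  have hb i t : h i (upd x b t) = upd y j (h j (upd x b t)) i.
    rewrite !ffunE; case: eqP => [->//|/eqP nij]; rewrite indep //.
    by apply: contra nij => /inE_dep bi; rewrite (dE _ _ _ bi (inE_dep _ _ dbj)).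
  have tE t : thr al0 al (upd y j (h j (upd x b t))) = t.
    by rewrite -[RHS]xP fE; congr thr; apply/ffunP => i; rewrite -hb [RHS]ffunE.
  have hj t : h j (upd x b t) = t.
    have le01 : h j (upd x b false) -> h j (upd x b true).
      by apply: (ro_mono (rh j)) => w; rewrite !ffunE; case: eqP.
    have : h j (upd x b false) != h j (upd x b true).
      by apply/eqP => e; have := tE true; rewrite -e tE.
    case: t; move: le01; (case: (h j _)); (case: (h j _)) => //; by move=> /(_ isT).
  by rewrite -[in LHS](hj s) tE.
have yE i t (ti : i != j) (lei : (al j <= al i)%R) := thr_exchange lei ti yP t.
have /choice[P HP] : forall i, exists p, ess (h i) (Ai i) p.
  by move=> i; apply: IH => a; rewrite !inE => /andP[].
have /choice[Z HZ] : forall i, exists Zi : bool -> assignment V,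
    forall s, Ai i != finset.set0 -> proj (h i) (Ai i) (P i) (Zi s) = s.
  move=> i; have [->|/set0Pn[a ai]] := eqVneq (Ai i) finset.set0.
    by exists (fun=> x).
  have /forall_inP/(_ a ai)/(mono_dep (mono_proj _ _ (ro_mono (rh i))))[z zP] := HP i.
  by exists (fun s => upd z a s) => s _; rewrite zP.
pose P' i := if Ai i == finset.set0 then x else P i.
pose p := glue E P' x; exists p; apply/forall_inP => a aA.
have [i di ai] := depA a aA.
have /forall_inP/(_ a ai)/(mono_dep (mono_proj _ _ (ro_mono (rh i))))[za zaP] := HP i.
have le_ji : (al j <= al i)%R by apply: jmin; apply/set0Pn; exists a.
pose y0 : assignment 'I_l := if i == j then y else upd y j (y i).
have y0P s : thr al0 al (upd y0 i s) = s.
  by rewrite /y0; case: eqVneq => [->|/yE->].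
pose W k := if k == i then za else Z k (y0 k).
pose z := glue E W x.
suff fz s : f (mix A (upd z a s) p) = s.
  by apply: (@depI _ _ _ z false true); rewrite /proj !fz.
rewrite fE -[RHS]y0P; congr thr; apply/ffunP => k; rewrite ffunE.
have gl Q k' w : w \in E k' -> glue E Q x w = Q k' w.
  by move=> wk; apply: glue_in => // k2 wk2; apply: dE wk2 wk.
have [->|nki] := eqVneq k i.
  rewrite upd_eq -[RHS]zaP; apply: eq_dep => w dw; have wi := inE_dep _ _ dw.
  rewrite !mixE !updE AiE // /z /p !(gl _ _ _ wi) /W /P' eqxx.
  by rewrite (negbTE (_ : Ai i != finset.set0)) //; apply/set0Pn; exists a.
have ak w : w \in E k -> w != a.
  by apply: contraTneq => ->; apply/negP => /(dE _ _ _ (inE_dep _ _ di))/esym/eqP/(negP nki).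
rewrite upd_neq //; have [k0|k0] := eqVneq (Ai k) finset.set0.
  have nkj : k != j by apply: contraTneq bj => <-; rewrite k0 inE.
  have -> : y0 k = h k x.
    by rewrite /y0; case: eqP => _; rewrite ?upd_neq // ffunE.
  apply: eq_dep => w dw; have wk := inE_dep _ _ dw.
  rewrite mixE -(AiE k) // k0 inE /p (gl _ _ _ wk) /P' k0 eqxx //.
rewrite -(HZ k (y0 k) k0); apply: eq_dep => w dw; have wk := inE_dep _ _ dw.
rewrite !mixE updE AiE // (negbTE (ak _ wk)) /z /p !(gl _ _ _ wk) /W /P'.
by rewrite (negbTE nki) (negbTE k0).
Qed.

End ReadOnce.

Section ReadOnceFormulas.
Variables (R : realType) (l : nat) (V : finType) (B : set gate).
Hypothesis Bmt : forall g, B g -> monotone_threshold R (projT2 g).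
Hypothesis Bl : forall g, B g -> projT1 g <= l.

Definition leaves (F : formula V) : {set V} := finset (fun v => 0 < occurrences v F).

Lemma formula_ro (F : formula V) :
  formula_over B F -> read_once_formula F -> ro R l (leaves F) (eval F).
Proof.
elim: F => [v _ _|[m gt] args IH /= [Bg oF] rF].
  by apply: (@ro_var _ _ _ _ _ v); rewrite // inE /= eqxx.
have lem : m <= l := Bl Bg.
have [al0 [al [al_ge0 gtE]]] := Bmt Bg; rewrite /= in al al_ge0 gtE.
have occ_le v k : occurrences v (args k) <= 1.
  by apply: leq_trans (rF v); rewrite /= (bigD1 k) //= leq_addr.
pose lift T (d : T) (u : 'I_m -> T) (i : nat) : T := if insub i is Some k then u k else d.
have liftT T (d : T) u (k : 'I_m) : lift T d u k = u k by rewrite /lift valK.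
pose h (i : 'I_l) := lift _ (fun=> false) (fun k => eval (args k)) i.
pose E (i : 'I_l) := lift _ finset.set0 (fun k => leaves (args k)) i.
apply: (@ro_gate _ _ _ _ _ al0 (fun i => lift _ 0%R al i) E h).
- by move=> i; rewrite /lift; case: insub => // k; apply: al_ge0.
- move=> i; rewrite /E /h /lift; case: insub => [k|]; last by apply: (@ro_const _ _ _ _ _ false).
  by apply: IH => // v; apply: occ_le.
- move=> i a; rewrite /E /lift; case: insub => [k|]; rewrite !inE // => ak.
  by rewrite /= (bigD1 k) //= ltn_addr.
- move=> i j a; rewrite /E /lift; case: insubP => [k _ ki|]; last by rewrite inE.
  case: insubP => [k' _ kj|]; last by move=> _ _; rewrite inE.
  rewrite !inE => ak ak'; apply: val_inj; rewrite /= -ki -kj; congr val.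
  apply/eqP/negPn/negP => nkk'; have := rF a; rewrite /= (bigD1 k) //= (bigD1 k') ?(eq_sym k') //=.
  by lia.
- move=> x /=; rewrite gtE /thr; congr (_ <= _)%R.
  pose F n := lift _ 0%R (fun k => al k * (eval (args k) x)%:R)%R n.
  transitivity (\sum_(i < m) F i)%R.
    by apply: eq_bigr => k _; rewrite /F liftT ffunE.
  rewrite (big_ord_widen l F lem) big_mkcond; apply: eq_bigr => i _.
  rewrite ffunE /F /h /lift; case: insubP => [k -> //|/negbTE ->].
  by rewrite mulr0.
Qed.

End ReadOnceFormulas.

(** * Decompositions around a variable *)

Section Decompositions.
Variables (l : nat) (V : finType).
Implicit Types (f : assignment V -> bool) (J : {set 'I_l}) (v a w : V) (c s t : bool).
Implicit Types (g : bool -> assignment 'I_l -> bool) (G : 'I_l -> assignment V -> bool).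
Implicit Types (Phi : bool -> assignment V -> bool).

(* [f x = Phi (g (x v) (G_j x)_(j in J)) x], where [v], the variables of the
   [G_j] and those of [Phi s] are pairwise disjoint; the arguments of [g]
   outside [J] are dummies. *)
Record predec v c f J g G Phi : Prop := Predec {
  predec_eq : forall x, f x = Phi (g (x v) [ffun j => G j x]) x;
  predec_gm : forall t, mono (g t);
  predec_gJ : forall t j, dep (g t) j -> j \in J;
  predec_gb : exists j, dep (g (~~ c)) j;
  predec_Gm : forall j, mono (G j);
  predec_G : forall j s, j \in J -> G j (cst s) = s;
  predec_Gv : forall j, j \in J -> ~~ dep (G j) v;
  predec_disj : forall i j a, i \in J -> j \in J -> dep (G i) a -> dep (G j) a -> i = j;
  predec_Phim : forall s, mono (Phi s);
  predec_Phis : forall x, Phi false x -> Phi true x;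
  predec_Phiv : forall s, ~~ dep (Phi s) v;
  predec_Phi : forall j a s, j \in J -> dep (G j) a -> ~~ dep (Phi s) a }.

Definition dec v c f J g G Phi :=
  predec v c f J g G Phi /\ forall j, j \in J -> dep (g c) j.

Lemma ro_predec (R : realType) D f v c : ro R l D f -> dep f v ->
  (forall x y, f (upd x v (~~ c)) = f (upd y v (~~ c))) \/
  exists J g G Phi, [/\ predec v c f J g G Phi,
    forall j, j \in J -> exists t, dep (g t) j &
    forall j a, j \in J -> dep (G j) a -> a \in D].
Proof.
set b := ~~ c => rf.
elim: rf => {D f} [D f s fE|D f w wD fE|D f al0 al E h ge0 rh IH ED dE fE] dv.
- by move: dv; rewrite (negbTE (const_indep _ _)) // => x y; rewrite !fE.
- left=> x y; rewrite !fE; suff -> : w = v by rewrite !upd_eq.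
  apply/eqP; apply: contraLR dv; rewrite eq_sym => nvw.
  by apply/existsPn => z; rewrite !fE !upd_neq ?eqxx // eq_sym.
have [i0 dvi] := gate_dep fE dv.
have inE_dep i a : dep (h i) a -> a \in E i by move/(ro_dep (rh i)).
have ndv i : i != i0 -> ~~ dep (h i) v.
  by apply: contra => dvi'; rewrite (dE _ _ _ (inE_dep _ _ dvi) (inE_dep _ _ dvi')).
pose gt := thr al0 al.
have gtm : mono gt by apply: thr_mono.
case: (IH i0 dvi) => [cst0|[J [g [G [Phi [[fE0 gm gJ gb Gm Gs Gv Gd Pm Ps Pv PG] gt0 GD]]]]]]; last first.
  right; exists J, g, G.
  exists (fun s x => gt [ffun i => if i == i0 then Phi s x else h i x]); split=> //.
  - split=> //.
    + move=> x; rewrite fE; congr gt; apply/ffunP => i; rewrite !ffunE.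
      by case: eqP => [->|//]; rewrite fE0.
    + move=> s x y xy; apply: gtm => i; rewrite !ffunE.
      by case: eqP => _; [apply: Pm|apply: (ro_mono (rh i))].
    + move=> x; apply: gtm => i; rewrite !ffunE.
      by case: eqP => _ //; apply: Ps.
    + move=> s; apply/existsPn => x; rewrite negbK; apply/eqP; congr gt.
      apply/ffunP => i; rewrite !ffunE; case: eqP => [_|/eqP/ndv nd]; by rewrite !indep.
    + move=> j a s jJ da; apply/existsPn => x; rewrite negbK; apply/eqP; congr gt.
      apply/ffunP => i; rewrite !ffunE; case: eqP => [_|/eqP nii].
        by rewrite !indep //; apply: PG da.
      suff nd : ~~ dep (h i) a by rewrite !indep.
      by apply: contra nii => /inE_dep ai; rewrite (dE _ _ _ ai (GD _ _ jJ da)).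
  - by move=> j a jJ /(GD _ _ jJ) /ED.
pose beta := h i0 (upd (cst false) v b).
pose G i x := h i (upd x v c).
pose K i := [forall x, G i x == G i (cst false)].
pose g t (y : assignment 'I_l) :=
  gt [ffun i => if (i == i0) && (t == b) then beta
                else if K i then G i (cst false) else y i].
pose J := finset (fun j => dep (g c) j || dep (g b) j).
have fE0 x : f x = g (x v) [ffun j => G j x].
  rewrite fE; congr gt; apply/ffunP => i; rewrite !ffunE.
  have hG k : (k != i0) || (x v == c) -> h k x = G k x.
    by rewrite /G => /orP[/ndv nd|/eqP <-]; [rewrite indep|rewrite upd_id].
  have KG k : h k x = G k x -> h k x = if K k then G k (cst false) else G k x.
    by case: ifP => // /forallP/(_ x)/eqP ->.
  case: eqP => [->|/eqP ni] /=; last by apply: KG; apply: hG; rewrite ni.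
  case: eqP => [xb|xnb]; first by rewrite -[in LHS](upd_id x v) xb; apply: cst0.
  by apply/KG/hG; rewrite eqxx /=; move: xnb; rewrite /b; case: (x v); case: (c).
have gJ t j : dep (g t) j -> j \in J.
  by rewrite inE /b; case: t; case: (c) => ->; rewrite ?orbT.
have NK j : j \in J -> ~~ K j.
  rewrite inE => dj; apply: contraL dj => Kj; rewrite negb_or.
  have nd t : ~~ dep (g t) j.
    apply/existsPn => y; rewrite negbK; apply/eqP; congr gt; apply/ffunP => i.
    by rewrite !ffunE; case: (i =P j) => [->|]; rewrite ?Kj.
  by rewrite !nd.
have Gm j : mono (G j).
  move=> x y xy; apply: (ro_mono (rh j)) => w; rewrite !updE.
  by case: eqP => // _; apply: xy.
have Gs j s : j \in J -> G j (cst s) = s.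
  move/NK=> Kj; case: (mono_cst (Gm j)) => // e.
  by case/negP: Kj; apply/forallP => x; apply/eqP.
have GE j a : dep (G j) a -> dep (h j) a && (a != v).
  case/existsP => x; have [->|nav] := eqVneq a v; first by rewrite /G !upd_upd eqxx.
  by rewrite /G !(updC _ _ _ nav) andbT => /depI.
have [/existsP gb|ngb] := boolP [exists j, dep (g b) j]; last first.
  left=> x y; rewrite !fE0 !upd_eq; apply: eq_dep => j dj.
  by case/negP: ngb; apply/existsP; exists j.
right; exists J, g, G, (fun s _ => s); split.
- split=> //.
  + by move=> t x y xy; apply: gtm => i; rewrite !ffunE; do 2![case: ifP => // _]; apply: xy.
  + by move=> j jJ; apply/negP => /GE; rewrite eqxx andbF.
  + move=> i j a _ _ /GE/andP[/inE_dep ai _] /GE/andP[/inE_dep aj _]; exact: dE ai aj.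
  + by move=> s x y.
  + by move=> s; apply: const_indep.
  + by move=> j a s _ _; apply: const_indep.
- move=> j; rewrite inE => /orP[]; [by exists c|by exists b].
- by move=> j a _ /GE/andP[/inE_dep /ED].
Qed.

End Decompositions.

Arguments predec_gm {l V v c f J g G Phi} _ t.
Arguments predec_Gm {l V v c f J g G Phi} _ j.
Arguments predec_Phim {l V v c f J g G Phi} _ s.
Arguments predec_Phis {l V v c f J g G Phi} _ x.

Section DecompositionTheory.
Variables (l : nat) (V : finType).
Implicit Types (f : assignment V -> bool) (J : {set 'I_l}) (v a w : V) (c s t : bool).
Implicit Types (g : bool -> assignment 'I_l -> bool) (G : 'I_l -> assignment V -> bool).
Implicit Types (Phi : bool -> assignment V -> bool).

Definition fam J G (j : 'I_l) : {set V} :=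
  if j \in J then finset (dep (G j)) else finset.set0.

Lemma in_fam J G j a : (a \in fam J G j) = (j \in J) && dep (G j) a.
Proof. by rewrite /fam; case: ifP; rewrite inE. Qed.

Lemma fam_inj v c f J g G Phi j a : predec v c f J g G Phi ->
  a \in fam J G j -> forall k, a \in fam J G k -> k = j.
Proof.
move=> d; rewrite in_fam => /andP[jJ da] k; rewrite in_fam => /andP[kJ dka].
exact: predec_disj d _ _ _ kJ jJ dka da.
Qed.

Lemma predec_glue v c f J g G Phi t (Y : 'I_l -> assignment V) x0 :
  predec v c f J g G Phi ->
  f (upd (glue (fam J G) Y x0) v t) = Phi (g t [ffun j => G j (Y j)]) x0.
Proof.
move=> d; rewrite (predec_eq d) upd_eq.
have -> : g t [ffun j => G j (upd (glue (fam J G) Y x0) v t)] =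
          g t [ffun j => G j (Y j)].
  apply: eq_dep => j /(predec_gJ d) jJ; rewrite !ffunE.
  rewrite indep ?(predec_Gv d) //; apply: eq_dep => a da.
  have aj : a \in fam J G j by rewrite in_fam jJ.
  exact: (glue_in _ _ (fam_inj d aj) aj).
rewrite indep ?(predec_Phiv d) //; apply: eq_dep => a da.
apply: glue_out => j; rewrite in_fam; apply/negP => /andP[jJ dja].
by move: da; rewrite (negbTE (predec_Phi d _ jJ dja)).
Qed.

Lemma predec_Phi_id v c f J g G Phi : predec v c f J g G Phi -> dep f v ->
  exists x0, forall s, Phi s x0 = s.
Proof.
move=> d /existsP[x]; rewrite !(predec_eq d) !upd_eq.
rewrite !(indep _ _ (predec_Phiv d _)) => ne; exists x => s.
have : Phi false x -> Phi true x by apply: (predec_Phis d).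
case E0: (Phi false x); case E1: (Phi true x); case: (s); rewrite ?E0 ?E1 //.
all: try by move=> /(_ isT).
all: by move: ne; case: (g _ _); case: (g _ _); rewrite ?E0 ?E1.
Qed.

Lemma predec_dep v c f J g G Phi t j a : predec v c f J g G Phi -> dep f v ->
  dep (g t) j -> dep (G j) a -> dep (fun x => f (upd x v t)) a.
Proof.
move=> d /(predec_Phi_id d)[x0 Px0] gj Gj.
have [y yP] := mono_dep (predec_gm d t) gj.
have [z zP] := mono_dep (predec_Gm d j) Gj.
have jJ := predec_gJ d gj.
have aj : a \in fam J G j by rewrite in_fam jJ.
pose Y s i := if i == j then upd z a s else cst (y i).
have YE s : glue (fam J G) (Y s) x0 = upd (glue (fam J G) (Y false) x0) a s.
  apply/ffunP => w; rewrite updE; case: eqP => [->|/eqP nwa].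
    by rewrite (glue_in _ _ (fam_inj d aj) aj) /Y eqxx upd_eq.
  by rewrite !ffunE; case: pickP => [i _|//]; rewrite /Y; case: eqP; rewrite // !upd_neq.
have fs s : f (upd (upd (glue (fam J G) (Y false) x0) a s) v t) = s.
  rewrite -YE (predec_glue _ _ _ d) Px0 -[RHS]yP; apply: eq_dep => i gi.
  rewrite ffunE /Y updE; case: eqP => [->//|_].
  by rewrite (predec_G d) // (predec_gJ d gi).
by apply: (@depI _ _ _ (glue (fam J G) (Y false) x0) false true); rewrite !fs.
Qed.

Lemma predec_dec v c f J g G Phi : predec v c f J g G Phi -> dep f v ->
  (forall a, a != v -> dep f a -> dep (fun x => f (upd x v c)) a) ->
  (forall j, j \in J -> exists t, dep (g t) j) -> dec v c f J g G Phi.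
Proof.
move=> d dv H gt0; split=> // j jJ; have [t gj] := gt0 j jJ.
have [a da] := cst_dep (fun s => predec_G d s jJ).
have nav : a != v by apply: contraTneq da => ->; exact: (predec_Gv d jJ).
have : dep f a.
  have /existsP[x] := predec_dep d dv gj da.
  by rewrite !(updC _ _ _ nav) => /depI.
move/(H a nav); apply: contraLR => ngj; apply/existsPn => x; rewrite negbK.
rewrite !(predec_eq d) !upd_eq !(indep _ _ (predec_Phiv d _)).
rewrite !(indep _ _ (predec_Phi d _ jJ da)); apply/eqP; congr Phi.
apply: eq_dep => i gi; rewrite !ffunE; have iJ := predec_gJ d gi.
rewrite !(indep _ _ (predec_Gv d iJ)).
have nd : ~~ dep (G i) a.
  by apply/negP => dia; move: ngj; rewrite -(predec_disj d iJ jJ dia da) gi.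
by rewrite !indep.
Qed.

End DecompositionTheory.

(* [op o] is the monotone binary gate with absorbing element [o]. *)
Definition op (o x y : bool) : bool := if o then x || y else x && y.

Lemma negb_neq (s o : bool) : s <> o -> s = ~~ o.
Proof. by case: s; case: o. Qed.

Section Irreducible.
Variables (l : nat) (V : finType).
Implicit Types (f : assignment V -> bool) (J : {set 'I_l}) (v a w : V) (c s t o : bool).
Implicit Types (g : bool -> assignment 'I_l -> bool) (G : 'I_l -> assignment V -> bool).
Implicit Types (Phi : bool -> assignment V -> bool).

Definition absorbing g (i : 'I_l) o := forall t y, g t (upd y i o) = o.

Definition exchangeable g (i j : 'I_l) o :=
  forall t y, g t (upd y i o) = g t (upd y j o).

Lemma in_setD1P J i j : (j \in finset.setD J [set i]%SET) = (j != i) && (j \in J).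
Proof. by rewrite !inE. Qed.

Lemma dec_absorbing v c f J g G Phi i o k :
  dec v c f J g G Phi -> i \in J -> absorbing g i o ->
  dep (fun y => g (~~ c) (upd y i (~~ o))) k ->
  exists g' Phi', dec v c f (finset.setD J [set i]%SET) g' G Phi'.
Proof.
case=> d gc iJ gi gk.
exists (fun t y => g t (upd y i (~~ o))), (fun s x => Phi (op o s (G i x)) x).
have dD t j : dep (fun y => g t (upd y i (~~ o))) j -> (j != i) && dep (g t) j.
  case/existsP => y; have [->|nji] := eqVneq j i; first by rewrite !upd_upd eqxx.
  by rewrite !(updC _ _ _ nji) => /depI.
have Phim s s' (x y : assignment V) : (s -> s') -> (forall a, x a -> y a) -> Phi s x -> Phi s' y.
  move=> ss' xy; have xy' : Phi s x -> Phi s y by apply: (predec_Phim d).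
  move=> /xy'; case: s s' ss' {xy'} => -[] // h; first by have := h isT.
  exact: (predec_Phis d).
split; last first.
  move=> j; rewrite in_setD1P => /andP[nji /gc] gj.
  have [y yP] := mono_dep (predec_gm d c) gj.
  have yi : y i = ~~ o.
    apply: negb_neq => yi; have := gi c (upd y j (~~ o)).
    have -> : upd (upd y j (~~ o)) i o = upd y j (~~ o).
      by rewrite updC // -yi upd_id.
    by rewrite yP; case: (o).
  apply: (@depI _ _ _ y false true).
  by rewrite !(updC _ _ _ nji) -yi upd_id !yP.
split=> //.
- move=> x; rewrite (predec_eq d); congr Phi.
  rewrite -{1}(upd_id [ffun j => G j x] i) ffunE.
  have [->|/eqP/negb_neq ->] := eqVneq (G i x) o.
    by rewrite gi /op; case: (o); rewrite ?orbT ?andbF.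
  by rewrite /op; case: (o); rewrite ?orbF ?andbT.
- move=> t x y xy; apply: (predec_gm d) => j; rewrite !updE.
  by case: eqP => // _; apply: xy.
- by move=> t j /dD/andP[nji /(predec_gJ d) jJ]; rewrite in_setD1P nji.
- by exists k.
- exact: (predec_Gm d).
- by move=> j s; rewrite in_setD1P => /andP[_]; apply: (predec_G d).
- by move=> j; rewrite in_setD1P => /andP[_]; apply: (predec_Gv d).
- move=> j j' a; rewrite !in_setD1P => /andP[_ jJ] /andP[_ j'J].
  exact: (predec_disj d).
- move=> s x y xy; apply: Phim => //.
  have := predec_Gm d i _ _ xy; rewrite /op.
  by case: (o); case: (s); case: (G i x) => //= ->.
- by move=> x; apply: Phim => //; rewrite /op; case: (o); case: (G i x).
- move=> s; apply/existsPn => x; rewrite negbK; apply/eqP.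
  by rewrite !(indep _ _ (predec_Gv d iJ)) !(indep _ _ (predec_Phiv d _)).
- move=> j a s; rewrite in_setD1P => /andP[nji jJ] da.
  apply/existsPn => x; rewrite negbK; apply/eqP.
  have nd : ~~ dep (G i) a.
    by apply: contra nji => dia; apply/eqP; apply: (predec_disj d _ _ da dia).
  by rewrite !(indep _ _ nd) !(indep _ _ (predec_Phi d _ jJ da)).
Qed.

Lemma dec_exchangeable v c f J g G Phi i j o :
  dec v c f J g G Phi -> i \in J -> j \in J -> i != j -> exchangeable g i j o ->
  exists g' G', dec v c f (finset.setD J [set j]%SET) g' G' Phi.
Proof.
case=> d gc iJ jJ nij gij.
pose g' t y := g t (upd y j (y i)).
pose G' k x := if k == i then op o (G i x) (G j x) else G k x.
have nji : j != i by rewrite eq_sym.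
have g'E t y : g t y = g' t (upd y i (op o (y i) (y j))).
  rewrite /g' upd_eq; set m := op _ _ _.
  have [mo|/eqP/negb_neq mo] := eqVneq m o; last first.
    have [yi yj] : y i = ~~ o /\ y j = ~~ o.
      by move: mo; rewrite /m /op; case: (o); case: (y i); case: (y j).
    by rewrite mo -{1}yi upd_id -yj upd_id.
  have e2 : g t (upd (upd y i o) j o) = g t (upd y j o).
    by rewrite updC // gij upd_upd.
  have e3 : g t (upd (upd y i o) j o) = g t (upd y i o) by rewrite e2 gij.
  rewrite mo; have [yi|/eqP/negb_neq yi] := eqVneq (y i) o.
    by rewrite e3 -yi upd_id.
  have yj : y j = o by move: mo; rewrite /m /op yi; case: (o); case: (y j).
  by rewrite e2 -yj upd_id.
have g'D t k : k != i -> k != j -> dep (g t) k -> dep (g' t) k.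
  move=> nki nkj /existsP[y]; rewrite !g'E !upd_neq // 1?eq_sym // => ne.
  apply: (@depI _ _ _ (upd y i (op o (y i) (y j))) false true).
  by rewrite -!(updC _ _ _ nki) eq_sym.
have nGi k a : dep (G' k) a -> (k = i /\ (dep (G i) a \/ dep (G j) a)) \/ dep (G k) a.
  rewrite /G'; case: (k =P i) => [->|_]; last by right.
  case/existsP => x ne; left; split=> //.
  have [|ni] := boolP (dep (G i) a); first by left.
  have [|nj] := boolP (dep (G j) a); first by right.
  by rewrite !(indep _ _ ni) !(indep _ _ nj) eqxx in ne.
have Gk k a : k \in J -> k != j -> dep (G' k) a ->
    exists2 m, m \in J & dep (G m) a /\ (m = k \/ m = j /\ k = i).
  move=> kJ nkj /nGi[[-> [da|da]]|da]; [exists i|exists j|exists k] => //; split=> //; by [left|right].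
exists g', G'; split; last first.
  move=> k; rewrite in_setD1P => /andP[nkj kJ].
  have [->|nki] := eqVneq k i; last by apply: g'D => //; apply: gc.
  have [y yP] := mono_dep (predec_gm d c) (gc i iJ).
  have yj : y j = ~~ o.
    apply: negb_neq => yj; have := yP (~~ o).
    have -> : g c (upd y i (~~ o)) = g c (upd y i o).
      have yE r : upd y i r = upd (upd y i r) j o.
        by rewrite updC // -yj upd_id.
      by rewrite (yE (~~ o)) (yE o) -!gij !upd_upd.
    by rewrite yP; case: (o).
  apply: (@depI _ _ _ y false true).
  suff e r : g' c (upd y i r) = r by rewrite !e.
  rewrite -[RHS](yP r) g'E !upd_eq upd_neq // yj upd_upd.
  by congr (g' c (upd _ _ _)); rewrite /op; case: (r); case: (o).
split=> //.
- move=> x; rewrite (predec_eq d); congr Phi; rewrite g'E; apply: congr1.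
  apply/ffunP => k; rewrite updE !ffunE /G'.
  by case: eqP.
- move=> t x y xy; apply: (predec_gm d) => k; rewrite !updE.
  by case: eqP => [_|_]; apply: xy.
- move=> t k /existsP[y ne]; rewrite in_setD1P; apply/andP; split.
    by apply: contraNneq ne => ->; rewrite /g' !upd_upd !upd_neq.
  apply: contraNT ne => nkJ; rewrite /g'.
  have nki : k != i by apply: contraNneq nkJ => ->.
  have nkj : k != j by apply: contraNneq nkJ => ->.
  have ngk : ~~ dep (g t) k by apply: contra nkJ; apply: predec_gJ d _ _.
  rewrite ![upd y k _ i]upd_neq 1?eq_sym //.
  by rewrite !(updC _ _ _ nkj) !(indep _ _ ngk).
- apply/existsP; apply: contraT; rewrite negb_exists => /forallP nd.
  have [k /existsP[y]] := predec_gb d; rewrite !g'E; case/eqP.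
  by apply: eq_dep => m; rewrite (negbTE (nd m)).
- move=> k x y xy; have Gm m : G m x -> G m y by apply: (predec_Gm d m).
  rewrite /G'; case: eqP => _; last exact: Gm.
  by rewrite /op; case: (o) => [/orP[/Gm->|/Gm->]|/andP[/Gm-> /Gm->]]; rewrite ?orbT.
- move=> k s; rewrite in_setD1P => /andP[_ kJ]; rewrite /G' !(predec_G d) //.
  by case: eqP => // _; rewrite /op; case: (o); case: (s).
- move=> k; rewrite in_setD1P => /andP[nkj kJ].
  apply/negP => /(Gk _ _ kJ nkj)[m mJ [dm _]].
  by move: dm; rewrite (negbTE (predec_Gv d mJ)).
- move=> k k' a; rewrite !in_setD1P => /andP[nkj kJ] /andP[nk'j k'J].
  move=> /(Gk _ _ kJ nkj)[m mJ [dm mk]] /(Gk _ _ k'J nk'j)[m' m'J [dm' mk']].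
  have mm' := predec_disj d mJ m'J dm dm'.
  case: mk mk' => [mk|[mk ki]] [mk'|[mk' ki']]; rewrite ?ki ?ki' //.
  - by rewrite -mk -mk'.
  - by move: nkj; rewrite -mk mm' mk' eqxx.
  - by move: nk'j; rewrite -mk' -mm' mk eqxx.
- exact: (predec_Phim d).
- exact: (predec_Phis d).
- exact: (predec_Phiv d).
- move=> k a s; rewrite in_setD1P => /andP[nkj kJ].
  move=> /(Gk _ _ kJ nkj)[m mJ [dm _]]; exact: (predec_Phi d _ mJ dm).
Qed.

Lemma dec_irreducible v c f J g G Phi : dec v c f J g G Phi ->
  exists J' g' G' Phi', [/\ dec v c f J' g' G' Phi',
    forall i o k, i \in J' -> absorbing g' i o ->
      ~~ dep (fun y => g' (~~ c) (upd y i (~~ o))) k &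
    forall i j o, i \in J' -> j \in J' -> i != j -> ~ exchangeable g' i j o].
Proof.
have [n] := ubnP #|J|; elim: n => // n IH in J g G Phi *.
rewrite ltnS => ltJ d.
have lt i : i \in J -> #|finset.setD J [set i]%SET| < n.
  by move=> iJ; apply: leq_trans ltJ; rewrite [X in _ < X](cardsD1 i) iJ.
have [[i [o [k [iJ ab gk]]]]|n1] := pselect (exists i o k, [/\ i \in J, absorbing g i o &
    dep (fun y => g (~~ c) (upd y i (~~ o))) k]).
  by have [g' [Phi' /(IH _ _ _ _ (lt i iJ))]] := dec_absorbing d iJ ab gk.
have [[i [j [o [iJ jJ nij ex]]]]|n2] := pselect (exists i j o,
    [/\ i \in J, j \in J, i != j & exchangeable g i j o]).
  by have [g' [G' /(IH _ _ _ _ (lt j jJ))]] := dec_exchangeable d iJ jJ nij ex.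
exists J, g, G, Phi; split=> //.
- by move=> i o k iJ ab; apply/negP => gk; apply: n1; exists i, o, k.
- by move=> i j o iJ jJ nij ex; apply: n2; exists i, j, o.
Qed.

End Irreducible.

(** * Uniqueness of one-variable extensions *)

Lemma bool_op (e : bool -> bool -> bool) :
  (forall s (r r' : bool), (r -> r') -> e s r -> e s r') ->
  (forall (s s' : bool) r, (s -> s') -> e s r -> e s' r) ->
  (exists s, e s false <> e s true) -> (exists r, e false r <> e true r) ->
  exists o, forall s r, e s r = op o s r.
Proof.
move=> m1 m2 [s0 h1] [r0 h2]; exists (e false true).
have a0 s : e s false ==> e s true by apply/implyP/m1.
have a1 r : e false r ==> e true r by apply/implyP/m2.
move/eqP: h1 => h1; move/eqP: h2 => h2.
move: h1 h2 (a0 false) (a0 true) (a1 false) (a1 true) => + + + + + + s r.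
case: s0 s; case: r0; case: r => -[];
  by case: (e false false); case: (e false true); case: (e true false); case: (e true true).
Qed.

Lemma opr (o x : bool) : op o x o = o.
Proof. by case: o; case: x. Qed.

Lemma op_neutral (o o' x : bool) : o != o' -> op o x o' = x.
Proof. by case: o; case: o'; case: x. Qed.

Section Local.
Variables (l : nat) (V : finType) (v : V) (c : bool) (f : assignment V -> bool).
Variables (J : {set 'I_l}) (g : bool -> assignment 'I_l -> bool).
Variables (G : 'I_l -> assignment V -> bool) (Phi : bool -> assignment V -> bool).
Hypothesis d : dec v c f J g G Phi.
Variables (A : {set V}) (p : assignment V) (X : 'I_l -> V) (u : V).
Hypothesis essA : ess (fun x => f (upd x v c)) A p.
Hypothesis XG : forall j, j \in J -> dep (G j) (X j).
Hypothesis XA : forall j, j \in J -> X j \in A.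
Hypothesis uA : u \in A.
Hypothesis AE : forall w, w \in A -> w = u \/ exists2 j, j \in J & w = X j.

Lemma local_eq x t : f (upd x v t) = Phi (g t [ffun j => G j x]) x.
Proof.
case: d => d0 _; rewrite (predec_eq d0) upd_eq (indep _ _ (predec_Phiv d0 _)).
congr Phi; apply: eq_dep => j /(predec_gJ d0) jJ.
by rewrite !ffunE (indep _ _ (predec_Gv d0 jJ)).
Qed.

Lemma local_depG j a : j \in J -> a \in A -> dep (G j) a -> dep (proj (G j) A p) a.
Proof.
move=> jJ aA da; case: d => d0 _; move/forall_inP/(_ a aA): essA.
apply: contraLR => nd; apply/existsPn => z; rewrite negbK /proj !local_eq.
have nP s z' r : Phi s (mix A (upd z' a r) p) = Phi s (mix A z' p).
  by rewrite mix_upd // (indep _ _ (predec_Phi d0 _ jJ da)).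
rewrite !nP; apply/eqP; congr Phi; apply: eq_dep => k /(predec_gJ d0) kJ.
rewrite !ffunE; have [dka|ndk] := boolP (dep (G k) a).
  by rewrite (predec_disj d0 kJ jJ dka da); have := indep _ _ nd; rewrite /proj => e; rewrite !e.
by rewrite !mix_upd // !(indep _ _ ndk).
Qed.

Lemma local_G j z : j \in J -> (dep (G j) u -> u = X j) -> G j (mix A z p) = z (X j).
Proof.
move=> jJ nu; case: d => d0 _; have Gm := mono_proj A p (predec_Gm d0 j).
have dX := local_depG jJ (XA jJ) (XG jJ).
have [z0 z0P] := mono_dep Gm dX.
rewrite -[RHS](z0P (z (X j))); apply: (@eq_dep _ (proj (G j) A p)) => a /dep_proj/andP[aA da].
have -> : a = X j.
  case: (AE aA) => [au|[k kJ ak]]; first by rewrite au nu // -au.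
  by rewrite ak (predec_disj d0 jJ kJ da _) // ak XG.
by rewrite upd_eq.
Qed.

Lemma local_Phi s z : (exists2 j, j \in J & dep (G j) u) -> Phi s (mix A z p) = s.
Proof.
case: d => d0 _ [i iJ du].
have cP s' z' : Phi s' (mix A z' p) = Phi s' (mix A z p).
  apply: (@eq_dep _ (proj (Phi s') A p)) => a /dep_proj/andP[aA].
  have [j jJ da] : exists2 j, j \in J & dep (G j) a.
    by case: (AE aA) => [->|[j jJ ->]]; [exists i|exists j; rewrite ?XG].
  by rewrite (negbTE (predec_Phi d0 _ jJ da)).
have /forall_inP/(_ u uA)/existsP[x] := essA.
rewrite /proj !local_eq !cP => ne.
have := predec_Phis d0 (mix A z p).
case E0: (Phi false _); case E1: (Phi true _); case: (s); rewrite ?E0 ?E1 //.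
all: try by move=> /(_ isT).
all: by move: ne; case: (g _ _); case: (g _ _); rewrite ?E0 ?E1.
Qed.

Lemma local_in i : i \in J -> dep (G i) u -> u != X i ->
  exists o, forall t z, f (upd (mix A z p) v t) =
    g t [ffun j => if j == i then op o (z (X i)) (z u) else z (X j)].
Proof.
move=> iJ du nuX; case: d => d0 _.
have Gm := mono_proj A p (predec_Gm d0 i).
pose pt s r := upd (upd (cst false) (X i) s) u r.
have nXu : X i != u by rewrite eq_sym.
have GE z : proj (G i) A p z = proj (G i) A p (pt (z (X i)) (z u)).
  apply: eq_dep => a /dep_proj/andP[aA da].
  case: (AE aA) da => [-> _|[k kJ ->] da]; first by rewrite upd_eq.
  by rewrite (predec_disj d0 kJ iJ (XG kJ) da) upd_neq // upd_eq.
have [o oP] : exists o, forall s r, proj (G i) A p (pt s r) = op o s r.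
  apply: bool_op => [s r r' h|s s' r h||].
  - by apply: Gm => a; rewrite !updE; case: eqP.
  - by apply: Gm => a; rewrite !updE; case: eqP => // _; case: eqP.
  - have /existsP[z ne] := local_depG iJ uA du; exists (z (X i)).
    by apply/eqP; move: ne; rewrite GE (GE (upd _ _ true)) !upd_eq !upd_neq.
  - have /existsP[z ne] := local_depG iJ (XA iJ) (XG iJ); exists (z u).
    by apply/eqP; move: ne; rewrite GE (GE (upd _ _ true)) !upd_eq !upd_neq.
exists o => t z; rewrite local_eq local_Phi; last by exists i.
apply: eq_dep => j /(predec_gJ d0) jJ; rewrite !ffunE; case: eqP => [->|nji].
  by rewrite -oP -GE.
by apply: local_G => // dju; case: nji; apply: (predec_disj d0 jJ iJ dju du).
Qed.

Lemma local_out : (forall j, j \in J -> ~~ dep (G j) u) ->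
  exists o, forall t z, f (upd (mix A z p) v t) =
    op o (g t [ffun j => z (X j)]) (z u).
Proof.
move=> nu; case: d => d0 gc.
have GX j z : j \in J -> G j (mix A z p) = z (X j).
  by move=> jJ; apply: local_G => // /(negP (nu j jJ)).
have fE t z : f (upd (mix A z p) v t) = Phi (g t [ffun j => z (X j)]) (mix A z p).
  by rewrite local_eq; congr Phi; apply: eq_dep => j /(predec_gJ d0) jJ; rewrite !ffunE GX.
have PE s z : Phi s (mix A z p) = Phi s (mix A (upd (cst false) u (z u)) p).
  apply: (@eq_dep _ (proj (Phi s) A p)) => a /dep_proj/andP[aA da].
  case: (AE aA) => [->|[k kJ ak]]; first by rewrite upd_eq.
  by move: da; rewrite ak (negbTE (predec_Phi d0 _ kJ (XG kJ))).
have [j0 /(predec_gJ d0) j0J] := predec_gb d0.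
have nXu j : j \in J -> X j != u.
  by move=> jJ; apply: contraNneq (nu j jJ) => <-; apply: XG.
have gu t z r : g t [ffun j => upd z u r (X j)] = g t [ffun j => z (X j)].
  by apply: eq_dep => j /(predec_gJ d0) jJ; rewrite !ffunE (negbTE (nXu _ jJ)).
have [o oP] : exists o, forall s r, Phi s (mix A (upd (cst false) u r) p) = op o s r.
  apply: bool_op => [s r r' h|s s' r h||].
  - by apply: (mono_proj A p (predec_Phim d0 s)) => a; rewrite !updE; case: eqP.
  - by case: s s' h => -[] // => [/(_ isT)|_] //; apply: (predec_Phis d0).
  - have /forall_inP/(_ u uA)/existsP[z] := essA.
    rewrite /proj !fE !gu PE [X in _ != X]PE !upd_eq => /eqP ne.
    by exists (g c [ffun j => z (X j)]).
  - have /forall_inP/(_ _ (XA j0J))/existsP[z] := essA.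
    rewrite /proj !fE PE [X in _ != X]PE !upd_neq 1?eq_sym ?nXu // => ne.
    exists (z u); move: ne.
    by move/eqP; case: (g _ _); case: (g _ _) => // /nesym.
by exists o => t z; rewrite fE PE oP.
Qed.

End Local.

Definition irreducible (l : nat) (c : bool) (J : {set 'I_l})
    (g : bool -> assignment 'I_l -> bool) :=
  (forall i o k, i \in J -> absorbing g i o ->
     ~~ dep (fun y => g (~~ c) (upd y i (~~ o))) k) /\
  (forall i j o, i \in J -> j \in J -> i != j -> ~ exchangeable g i j o).

(* The queries on this subcube show how [u] enters [f] relative to the
   representatives [X j]. *)
Definition probe (l : nat) (V : finType) (v : V) (c : bool) (f f' : assignment V -> bool)
    (J : {set 'I_l}) (X : 'I_l -> V) (u : V) :=
  exists A p, [/\ ess (fun x => f (upd x v c)) A p,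
    u \in A, forall j, j \in J -> X j \in A,
    forall w, w \in A -> w = u \/ exists2 j, j \in J & w = X j &
    forall t z, f (upd (mix A z p) v t) = f' (upd (mix A z p) v t)].

Section Uniqueness.
Variables (l : nat) (V : finType) (v : V) (c : bool).
Variables (J : {set 'I_l}) (g : bool -> assignment 'I_l -> bool) (X : 'I_l -> V).
Implicit Types (f : assignment V -> bool).
Implicit Types (G : 'I_l -> assignment V -> bool) (Phi : bool -> assignment V -> bool).
Hypothesis irr : irreducible c J g.

Lemma place_values (y : assignment 'I_l) u s :
  (forall j, j \in J -> X j != u) -> (forall j k, j \in J -> k \in J -> X j = X k -> j = k) ->
  exists z : assignment V, z u = s /\ forall j, j \in J -> z (X j) = y j.
Proof.
move=> nXu injX.
exists [ffun w => if w == u then s else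
  if [pick j | (j \in J) && (X j == w)] is Some j then y j else false].
rewrite ffunE eqxx; split=> // j jJ; rewrite ffunE (negbTE (nXu j jJ)).
case: pickP => [k /andP[kJ /eqP /(injX _ _ kJ jJ) ->] //|/(_ j)].
by rewrite jJ eqxx.
Qed.

(* If [u] lay elsewhere in [f'], giving [u] the absorbing value in both local
   forms would make [g] absorbing or exchangeable. *)
Lemma same_block f f' G G' Phi Phi' i u :
  dec v c f J g G Phi -> dec v c f' J g G' Phi' ->
  (forall x, f (upd x v c) = f' (upd x v c)) ->
  (forall j, j \in J -> dep (G j) (X j)) -> (forall j, j \in J -> dep (G' j) (X j)) ->
  (dep (G i) u -> probe v c f f' J X u) ->
  i \in J -> (forall o, ~ absorbing g i o) -> dep (G i) u -> dep (G' i) u.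
Proof.
move=> d d' eqc XG XG' + iJ nab du.
have [->|nuX] := eqVneq u (X i); first by move=> _; apply: XG'.
case/(_ du) => A [p [essA uA XA AE agr]].
have essA' : ess (fun x => f' (upd x v c)) A p.
  by congr (ess _ A p): essA; apply/funext.
have injX j k : j \in J -> k \in J -> X j = X k -> j = k.
  move=> jJ kJ e; case: d => d0 _; apply: (predec_disj d0 jJ kJ (XG j jJ)).
  by rewrite e XG.
have nXu j : j \in J -> X j != u.
  move=> jJ; apply: contraNneq nuX => Xu; case: d => d0 _.
  by rewrite -Xu (predec_disj d0 jJ iJ (XG j jJ)) // Xu.
have [o oP] := local_in d essA XG XA uA AE iJ du nuX.
have gD t j : dep (g t) j -> j \in J by case: d => d0 _; apply: (predec_gJ d0).
have lhs t (y : assignment 'I_l) s (z : assignment V) : z u = s -> (forall j, j \in J -> z (X j) = y j) ->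
    f' (upd (mix A z p) v t) = g t (upd y i (op o (y i) s)).
  move=> zu zX; rewrite -agr oP; apply: eq_dep => j /gD jJ.
  by rewrite !ffunE zX // zu zX.
have [/existsP[i' /andP[i'J du']]|none] := boolP [exists j, (j \in J) && dep (G' j) u].
  have [<- //|ni] := eqVneq i' i.
  have nuX' : u != X i' by rewrite eq_sym nXu.
  have [o' oP'] := local_in d' essA' XG' XA uA AE i'J du' nuX'.
  have E t y s : g t (upd y i (op o (y i) s)) = g t (upd y i' (op o' (y i') s)).
    have [z [zu zX]] := place_values y s nXu injX.
    rewrite -(lhs t y s z) // oP'; apply: eq_dep => j /gD jJ.
    by rewrite !ffunE zX // zu zX.
  have [eoo|noo] := eqVneq o' o.
    case: (irr.2 i i' o iJ i'J); first by rewrite eq_sym.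
    by move=> t y; have := E t y o; rewrite eoo !opr.
  case: d => _ /(_ i iJ)/existsP[y]; rewrite -[upd y i true](upd_upd y i false).
  have Eo y' : g c (upd y' i o) = g c y'.
    by have := E c y' o; rewrite opr op_neutral // upd_id.
  by rewrite -(Eo (upd y i false)) -(Eo (upd _ i true)) !upd_upd eqxx.
have nu j : j \in J -> ~~ dep (G' j) u.
  move=> jJ; apply: contra none => dj; apply/existsP; exists j; exact/andP.
have [o' oP'] := local_out d' essA' XG' XA uA AE nu.
have E t y s : g t (upd y i (op o (y i) s)) = op o' (g t y) s.
  have [z [zu zX]] := place_values y s nXu injX.
  rewrite -(lhs t y s z) // oP' zu; congr op; apply: eq_dep => j /gD jJ.
  by rewrite !ffunE zX.
have [eoo|noo] := eqVneq o o'.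
  by case: (nab o) => t y; have := E t y o; rewrite -eoo !opr.
case: d => _ /(_ i iJ)/existsP[y].
have Eo y' : g c y' = o' by have := E c y' o'; rewrite opr op_neutral // upd_id.
by rewrite !Eo eqxx.
Qed.

Lemma absorbing_id f G Phi i o y : dec v c f J g G Phi ->
  i \in J -> absorbing g i o -> g (~~ c) y = y i.
Proof.
case=> d _ iJ ab.
have [yo|/eqP/negb_neq yo] := eqVneq (y i) o; first by rewrite -(upd_id y i) yo ab upd_eq.
have gE (z : assignment 'I_l) : z i = ~~ o -> g (~~ c) z = g (~~ c) (upd (cst false) i (~~ o)).
  move=> zi; rewrite -(upd_id z i) zi.
  apply: (@eq_dep _ (fun y => g (~~ c) (upd y i (~~ o)))) => k.
  by rewrite (negbTE (irr.1 i o k iJ ab)).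
rewrite gE //; apply: contraTeq (erefl true) => /eqP; rewrite yo => /negb_neq.
rewrite negbK => e; case: (predec_gb d) => k.
suff cE z : g (~~ c) z = o by case/existsP=> z; rewrite !cE eqxx.
by have [zo|/eqP/negb_neq/gE ->//] := eqVneq (z i) o; rewrite -(upd_id z i) zo ab.
Qed.

Lemma absorbing_eq f G Phi i o x : dec v c f J g G Phi ->
  i \in J -> absorbing g i o ->
  f (upd x v (~~ c)) =
  f (upd [ffun w => if [exists j, [&& j \in J, j != i & dep (G j) w]]
                    then ~~ o else x w] v c).
Proof.
move=> d iJ ab; rewrite !(local_eq d) (absorbing_id _ d iJ ab) ffunE.
set x' : assignment V := [ffun w => if _ then _ else _]; case: (d) => d0 gc.
have -> : Phi (g c [ffun j => G j x']) x' = Phi (g c [ffun j => G j x']) x.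
  apply: eq_dep => w dw; rewrite ffunE; case: existsP => // -[j /and3P[jJ _ djw]].
  by move: dw; rewrite (negbTE (predec_Phi d0 _ jJ djw)).
have -> : g c [ffun j => G j x'] = g c (upd (cst (~~ o)) i (G i x)).
  apply: eq_dep => j /(predec_gJ d0) jJ; rewrite updE !ffunE.
  case: eqP => [->|/eqP nji].
    apply: eq_dep => w dw; rewrite ffunE; case: existsP => // -[k /and3P[kJ nki dkw]].
    by move: nki; rewrite (predec_disj d0 kJ iJ dkw dw) eqxx.
  rewrite -[RHS](predec_G d0 (~~ o) jJ); apply: eq_dep => w dw.
  rewrite !ffunE; case: existsP => // -[]; exists j; exact/and3P.
congr Phi; have [->|/eqP/negb_neq ->] := eqVneq (G i x) o; first by rewrite ab.
have -> : upd (cst (~~ o)) i (~~ o) = cst (~~ o) :> assignment 'I_l.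
  by apply/ffunP => j; rewrite !ffunE; case: eqP.
by rewrite (mono_dep_cst _ (predec_gm d0 c) (gc i iJ)).
Qed.

Lemma dec_unique f f' G G' Phi Phi' :
  dec v c f J g G Phi -> dec v c f' J g G' Phi' -> dep f v -> dep f' v ->
  (forall x, f (upd x v c) = f' (upd x v c)) ->
  (forall j, j \in J -> dep (G j) (X j)) -> (forall j, j \in J -> dep (G' j) (X j)) ->
  (forall u, dep (fun x => f (upd x v c)) u -> probe v c f f' J X u) ->
  f =1 f'.
Proof.
move=> d d' dv dv' eqc XG XG' pr.
have eqc' : (fun x => f (upd x v c)) = (fun x => f' (upd x v c)) by apply/funext.
have pr' u : dep (fun x => f' (upd x v c)) u -> probe v c f' f J X u.
  rewrite -eqc' => /pr[A [p [essA uA XA AE agr]]].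
  by exists A, p; split=> //; rewrite -eqc'.
have GE j u : j \in J -> (forall o, ~ absorbing g j o) -> dep (G j) u = dep (G' j) u.
  move=> jJ nab; apply/idP/idP.
    apply: (same_block d d' eqc XG XG') => // dju; apply: pr.
    by case: (d) => d0 gc; apply: (predec_dep d0 dv (gc j jJ)).
  apply: (same_block d' d (fun x => esym (eqc x)) XG' XG) => // dju; apply: pr'.
  by case: (d') => d0 gc; apply: (predec_dep d0 dv' (gc j jJ)).
suff eqb x : f (upd x v (~~ c)) = f' (upd x v (~~ c)).
  move=> x; rewrite -(upd_id x v).
  by have [->//|/eqP/negb_neq ->] := eqVneq (x v) c.
have [[i [o [iJ ab]]]|nab] := pselect (exists i o, i \in J /\ absorbing g i o).
  rewrite (absorbing_eq x d iJ ab) (absorbing_eq x d' iJ ab) eqc.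
  congr (f' (upd _ v c)); apply/ffunP => w; rewrite !ffunE.
  congr (if _ then _ else _); apply: eq_existsb => j; apply: andb_id2l => jJ.
  apply: andb_id2l => nji; apply: GE => // o' ab'.
  pose y : assignment 'I_l := upd (cst false) i true.
  have := absorbing_id y d iJ ab; rewrite (absorbing_id y d jJ ab') !updE eqxx.
  by rewrite (negbTE nji) ffunE.
have {}GE j u : j \in J -> dep (G j) u = dep (G' j) u.
  by move=> jJ; apply: GE => // o ab; apply: nab; exists j, o.
case: (d) (d') => d0 gc [d0' gc'].
have famE : fam J G = fam J G'.
  apply/funext => j; apply/setP => u; rewrite !in_fam.
  by apply: andb_id2l; apply: GE.
have [x0 Px0] := predec_Phi_id d0 dv.
have GG j z : j \in J -> G j z = G' j z.
  move=> jJ; have [y yP] := mono_dep (predec_gm d0 c) (gc j jJ).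
  have key H : (forall k s, k \in J -> H k (cst s) = s) -> forall z',
      g c [ffun k => H k (if k == j then z' else cst (y k))] = H j z'.
    move=> Hs z'; rewrite -[RHS]yP; apply: eq_dep => k /(predec_gJ d0) kJ.
    by rewrite !ffunE; case: eqP => [->|_]; rewrite ?Hs.
  have GP z' : G j z' = Phi' (G' j z') x0.
    pose Y k := if k == j then z' else cst (y k).
    have := eqc (glue (fam J G) Y x0).
    rewrite {2}famE (predec_glue _ _ _ d0) (predec_glue _ _ _ d0') Px0.
    rewrite !key //; first exact: predec_G d0'.
    exact: predec_G d0.
  rewrite GP; have := GP (cst (G' j z)).
  by rewrite (predec_G d0) // (predec_G d0').
have PP s z : Phi s z = Phi' s z.
  have := eqc (glue (fam J G) (fun=> cst s) z).
  rewrite {2}famE (predec_glue _ _ _ d0) (predec_glue _ _ _ d0').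
  have [k /(predec_gJ d0) kJ] := predec_gb d0.
  have gs H : (forall k s, k \in J -> H k (cst s) = s) -> g c [ffun j => H j (cst s)] = s.
    move=> Hs; rewrite -[RHS](mono_dep_cst s (predec_gm d0 c) (gc k kJ)).
    by apply: eq_dep => j /(predec_gJ d0) jJ; rewrite !ffunE Hs.
  by rewrite !gs //; [exact: predec_G d0'|exact: predec_G d0].
rewrite !(local_eq d) !(local_eq d') PP; congr Phi'; apply: eq_dep => j /(predec_gJ d0) jJ.
by rewrite !ffunE GG.
Qed.

End Uniqueness.

Section Extension.
Variables (R : realType) (l : nat) (V : finType).
Implicit Types (f phi : assignment V -> bool) (v a w u : V) (c s t : bool).

Definition ro_class f := exists D, ro R l D f.

Definition skeleton : finType :=
  ({set 'I_l} * {ffun bool * assignment 'I_l -> bool} * {ffun 'I_l -> V})%type.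

Definition has_skeleton v c f (k : skeleton) :=
  exists G Phi, [/\ dec v c f k.1.1 (fun s y => k.1.2 (s, y)) G Phi,
    irreducible c k.1.1 (fun s y => k.1.2 (s, y)) &
    forall j, j \in k.1.1 -> dep (G j) (k.2 j)].

Definition signature : finType := (bool * bool * bool * option skeleton)%type.

Definition sig_of v c f : signature :=
  (dep f v, [forall x, f (upd x v (~~ c)) == f (upd (cst false) v (~~ c))],
   f (upd (cst false) v (~~ c)), [pick k | `[< has_skeleton v c f k >]]).

Lemma ro_skeleton v c f : ro_class f -> dep f v ->
  (forall a, a != v -> dep f a -> dep (fun x => f (upd x v c)) a) ->
  ~~ [forall x, f (upd x v (~~ c)) == f (upd (cst false) v (~~ c))] ->
  exists k, has_skeleton v c f k.
Proof.
move=> [D rf] dv H ncst.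
have [e|[J0 [g0 [G0 [Phi0 [d0 gt0 _]]]]]] := ro_predec c rf dv.
  by case/negP: ncst; apply/forallP => x; apply/eqP.
have d := predec_dec d0 dv H gt0.
have [J [g [G [Phi [dg irr1 irr2]]]]] := dec_irreducible d.
have /choice[X XG] : forall j, exists a, j \in J -> dep (G j) a.
  move=> j.
  have [jJ|] := boolP (j \in J); last by exists v.
  have [a da] := cst_dep (fun s => predec_G dg.1 s jJ).
  by exists a.
exists (J, [ffun q => g q.1 q.2], finfun X), G, Phi => /=.
have -> : (fun s y => [ffun q => g q.1 q.2] (s, y)) = g.
  by apply/funext => s; apply/funext => y; rewrite ffunE.
by split=> // j jJ; rewrite ffunE XG.
Qed.

Section Probes.
Variables (v : V) (phi : assignment V -> bool).

Definition probe_point (q : {ffun 'I_l.+1 -> V} * {ffun 'I_l.+1 -> bool} * bool) :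
    assignment V :=
  let: (a, y, t) := q in
  let p := odflt (cst false) [pick p | ess phi (a @: setT) p] in
  upd [ffun w => if [pick i | a i == w] is Some i then y i else p w] v t.

Definition probes : seq (assignment V) := codom probe_point.

Lemma size_probes : size probes = #|V| ^ l.+1 * 2 ^ l.+1 * 2.
Proof. by rewrite size_codom !card_prod !card_ffun !card_bool card_ord. Qed.

Lemma probes_probe c f f' (J : {set 'I_l}) (X : 'I_l -> V) u : ro_class f ->
  (forall x, f (upd x v c) = phi x) ->
  {in probes, forall x, f x = f' x} ->
  (forall j, j \in J -> dep phi (X j)) -> dep phi u ->
  probe v c f f' J X u.
Proof.
move=> [D rf] fphi agr dX du.
pose a : {ffun 'I_l.+1 -> V} :=
  [ffun i => if insub (val i) is Some j then if j \in J then X j else u else u].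
pose A := a @: setT.
have aA i : a i \in A by apply: imset_f; rewrite inE.
have da i : dep phi (a i).
  by rewrite ffunE; case: insub => // j; case: ifP => // /dX.
have rphi : ro R l D phi.
  have -> : phi = proj f [set~ v]%SET (cst c).
    apply/funext => x; rewrite -fphi /proj; congr f; apply/ffunP => w.
    by rewrite !ffunE !inE; case: eqP.
  exact: ro_proj.
have [p0 essp0] : exists p, ess phi A p.
  by apply: (ro_sep rphi) => w /imsetP[i _ ->].
pose p := odflt (cst false) [pick p | ess phi A p].
have essp : ess phi A p by rewrite /p; case: pickP => // /(_ p0); rewrite essp0.
exists A, p; split.
- by rewrite (_ : (fun x => f (upd x v c)) = phi) //; apply/funext.
- have <- : a ord_max = u by rewrite ffunE insubF //= ltnn.
  exact: aA.
- move=> j jJ; have <- : a (widen_ord (leqnSn l) j) = X j.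
    by rewrite ffunE /= valK jJ.
  exact: aA.
- move=> w /imsetP[i _ ->]; rewrite ffunE; case: insub => [j|]; last by left.
  by case: ifP => [jJ|_]; [right; exists j|left].
- move=> t z; apply: agr; apply/codomP; exists (a, [ffun i => z (a i)], t).
  congr (upd _ v t); apply/ffunP => w; rewrite !ffunE -/A -/p.
  case: pickP => [i /eqP <-|nw]; first by rewrite aA [RHS]ffunE.
  by rewrite ifN //; apply/negP => /imsetP[i _ wi]; have := nw i; rewrite wi eqxx.
Qed.

End Probes.

Lemma extension_unique v c phi f f' : ro_class f -> ro_class f' ->
  (forall x, f (upd x v c) = phi x) -> (forall x, f' (upd x v c) = phi x) ->
  (forall a, a != v -> dep f a -> dep phi a) ->
  (forall a, a != v -> dep f' a -> dep phi a) ->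
  {in probes v phi, forall x, f x = f' x} ->
  sig_of v c f = sig_of v c f' -> f =1 f'.
Proof.
move=> rf rf' fE fE' H H' agr [dvv cc vv pp] x.
have fpE : (fun x => f (upd x v c)) = phi by apply/funext.
have fpE' : (fun x => f' (upd x v c)) = phi by apply/funext.
have [dv|ndv] := boolP (dep f v); last first.
  by rewrite -(indep x c ndv) -(indep x c (_ : ~~ dep f' v)) -?dvv // fE fE'.
have dv' : dep f' v by rewrite -dvv.
have [cf|ncf] := boolP [forall x, f (upd x v (~~ c)) == f (upd (cst false) v (~~ c))].
  have cf' := cf; rewrite cc in cf'.
  rewrite -(upd_id x v); have [->|/eqP/negb_neq ->] := eqVneq (x v) c.
    by rewrite fE fE'.
  by rewrite (eqP (forallP cf x)) (eqP (forallP cf' x)).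
have [|k0 k0P] := ro_skeleton rf dv _ ncf; first by rewrite fpE.
move: pp; case: pickP => [k /asboolP[G [Phi [d irr XG]]]|/(_ k0)]; last first.
  by move/negbT/asboolPn.
case: pickP => // k' /asboolP[G' [Phi' [d' _ XG']]] /Some_inj ek; rewrite -ek in d' XG'.
apply: (dec_unique irr d d' dv dv' _ XG XG') => [z|u]; first by rewrite fE fE'.
rewrite fpE; apply: probes_probe => // j jJ.
by rewrite -fpE; case: (d) => d0 gc; apply: (predec_dep d0 dv (gc j jJ)); apply: XG.
Qed.

Lemma card_signature : #|signature| = 8 * (2 ^ l * 2 ^ (2 * 2 ^ l) * #|V| ^ l).+1.
Proof.
rewrite !card_prod card_option !card_prod !card_ffun card_bool card_prod card_bool.
by rewrite card_ffun card_bool card_ord -cardsT -powersetT card_powerset cardsT card_ord.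
Qed.

End Extension.

(** * The learning algorithm *)

Section Identifiable.
Variable V : finType.
Implicit Types (C : bfun V -> Prop) (k : nat) (Q : seq (assignment V)).

Definition identifiable k C :=
  exists A : algorithm V, forall f, C f -> run A f = f /\ queries_used A f <= k.

Lemma identifiable_sub k k' C C' : k <= k' -> (forall f, C' f -> C f) ->
  identifiable k C -> identifiable k' C'.
Proof.
move=> kk sC [A HA]; exists A => f /sC/HA[-> le]; split=> //.
exact: leq_trans le kk.
Qed.

Lemma identifiable_leq k k' C : k <= k' -> identifiable k C -> identifiable k' C.
Proof. by move/identifiable_sub; apply. Qed.

Lemma identifiable_single k C h : (forall f, C f -> f = h) -> identifiable k C.
Proof. by move=> Ch; exists (Output h) => f /Ch ->. Qed.

Lemma identifiable_seq Q k C :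
  (forall h, C h -> identifiable k (fun f => C f /\ {in Q, f =1 h})) ->
  identifiable (size Q + k) C.
Proof.
elim: Q C => [|x Q IH] C H.
  have [[h Ch]|none] := pselect (exists h, C h).
    by apply: identifiable_sub (H h Ch).
  by exists (Output [ffun=> false]) => f Cf; case: none; exists f.
have /choice[A HA] : forall s, exists A : algorithm V, forall f, C f /\ f x = s ->
    run A f = f /\ queries_used A f <= size Q + k.
  move=> s; apply: IH => h [Ch hx]; apply: identifiable_sub (H h Ch) => // f [[Cf fx] fQ].
  split=> // z; rewrite inE => /predU1P[->|/fQ //]; by rewrite fx hx.
exists (Ask (Membership x) (A false) (A true)) => f Cf /=.
have -> : (if f x then A true else A false) = A (f x) by case: (f x).
by have [-> le] := HA (f x) f (conj Cf erefl); rewrite addSn ltnS.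
Qed.

End Identifiable.

Section Learning.
Variables (R : realType) (l n : nat).
Local Notation V := 'I_n.
Implicit Types (f phi psi h : bfun V) (S : {set V}) (p x : assignment V).
Implicit Types (T : seq (assignment V)).

Definition bproj f S p : bfun V := [ffun x => f (mix S x p)].

Definition teaches S T phi := forall psi : bfun V, ro_class R l psi ->
  (forall a, dep psi a -> a \in S) -> {in T, psi =1 phi} -> psi = phi.

Definition separator (f f' : bfun V) : assignment V :=
  odflt (cst false) [pick x | f x != f' x].

Definition separators (C : {set bfun V}) : seq (assignment V) :=
  [seq separator q.1 q.2 | q <- enum (finset.setX C C)].

Lemma size_separators C : size (separators C) = #|C| ^ 2.
Proof. by rewrite size_map -cardE cardsX expnS expn1. Qed.

Lemma separatorsP (C : {set bfun V}) f f' : f \in C -> f' \in C -> {in separators C, f =1 f'} -> f = f'.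
Proof.
move=> fC f'C agr; have : f (separator f f') = f' (separator f f').
  apply: agr; apply/mapP; exists (f, f') => //.
  by rewrite mem_enum finset.in_setX fC.
rewrite /separator; case: pickP => [x /negbTE nx /eqP|e _]; first by rewrite nx.
by apply/ffunP => x; apply/eqP; have /negbFE := e x.
Qed.

Lemma ro_bproj f S p : ro_class R l f -> ro_class R l (bproj f S p).
Proof.
case=> D rf; exists D; have -> : (bproj f S p : assignment V -> bool) = proj f S p.
  by apply/funext => x; rewrite ffunE.
exact: ro_proj.
Qed.

Lemma ro_restrict f v c : ro_class R l f -> ro_class R l [ffun x => f (upd x v c)].
Proof.
move=> rf; have -> : [ffun x => f (upd x v c)] = bproj f (finset.setC [set v]%SET) (cst c).
  apply/ffunP => x; rewrite !ffunE; congr (f _); apply/ffunP => w.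
  by rewrite !ffunE !inE; case: eqP.
exact: ro_bproj.
Qed.

Definition cands v c phi S h : {set bfun V} :=
  finset (fun psi => `[< [/\ ro_class R l psi, (forall x, psi (upd x v c) = phi x),
    (forall a, dep psi a -> a \in (v |: S)%SET) & {in probes l v phi, psi =1 h}] >]).

Lemma card_cands v c phi S h : (forall a, a \in S -> dep phi a) ->
  #|cands v c phi S h| <= #|signature l V|.
Proof.
move=> dphi; rewrite -(card_in_imset (f := fun psi : bfun V => sig_of l v c psi)).
  exact: max_card.
move=> f f'; rewrite /cands !finset.in_set => /asboolP[rf fE fS fP] /asboolP[rf' fE' fS' fP'] e.
apply/ffunP; apply: (extension_unique rf rf' fE fE' _ _ _ e).
- by move=> a nav /fS; rewrite in_setU1 (negbTE nav) => /dphi.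
- by move=> a nav /fS'; rewrite in_setU1 (negbTE nav) => /dphi.
- by move=> x xP; rewrite fP // fP'.
Qed.

Definition path p (b : bool) (i : nat) : assignment V :=
  [ffun w : V => if w < i then b else p w].

Definition ext_cost := n ^ l.+1 * 2 ^ l.+1 * 2 + #|signature l V| ^ 2.

Definition step_cost := 2 * n.+1 * (n * ext_cost + 1) + ext_cost.

Lemma pathS p b i (lt : i < n) : path p b i.+1 = upd (path p b i) (Ordinal lt) b.
Proof.
apply/ffunP => w; rewrite !ffunE ltnS leq_eqVlt -val_eqE /=.
by case: eqP.
Qed.

Lemma mix_upd_out S x p v c : v \notin S ->
  mix (v |: S)%SET (upd x v c) p = mix S x (upd p v c).
Proof.
move=> vS; apply/ffunP => w; rewrite !ffunE in_setU1.
by case: eqP => [->|]; rewrite ?(negbTE vS).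
Qed.

Lemma identifiable_step m S p phi T : n - #|S| <= m ->
  ro_class R l phi -> (forall a, dep phi a = (a \in S)) -> teaches S T phi ->
  size T <= #|S| * ext_cost + 1 ->
  identifiable (m * step_cost) (fun f => ro_class R l f /\ bproj f S p = phi).
Proof.
elim: m S p phi T => [|m IH] S p phi T leS rphi dphi teach sT.
  apply: (@identifiable_single _ _ _ phi) => f [_ <-]; apply/ffunP => x; rewrite ffunE.
  congr (f _); apply/ffunP => w; rewrite ffunE.
  suff -> : w \in S by [].
  suff -> : S = [set: V]%SET by rewrite inE.
  by apply/eqP; rewrite eqEcard finset.subsetT cardsT card_ord; lia.
pose Q1 := [seq mix S q.2 (path p q.1.1 q.1.2) |
  q <- [seq (bi, t) | bi <- [seq (b, i) | b <- [:: true; false], i <- iota 0 n.+1], t <- T]].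
have sQ1 : size Q1 = 2 * n.+1 * size T.
  by rewrite size_map !size_allpairs size_iota.
have Q1P b i t : i <= n -> t \in T -> mix S t (path p b i) \in Q1.
  move=> lei tT; apply/mapP; exists (b, i, t) => //.
  apply: allpairs_f => //; apply: allpairs_f; first by case: b.
  by rewrite mem_iota add0n ltnS.
have leST : #|S| <= n by rewrite -[X in _ <= X]card_ord max_card.
have sT' : size T <= n * ext_cost + 1.
  by apply: (leq_trans sT); rewrite leq_add2r leq_mul2r leST orbT.
apply: (@identifiable_leq _ (size Q1 + (ext_cost + m * step_cost))).
  rewrite mulSn /step_cost sQ1 addnA leq_add2r leq_add2r leq_mul2l sT'.
  by rewrite orbT.
apply: identifiable_seq => h [rh hphi].
pose good b i := all (fun t => h (mix S t (path p b i)) == phi t) T.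
have goodP f b i : ro_class R l f -> {in Q1, f =1 h} -> i <= n -> good b i ->
    bproj f S (path p b i) = phi.
  move=> rf fQ lei /allP gd; apply: teach; first exact: ro_bproj.
    by move=> a; rewrite (dep_ext (f' := proj f S (path p b i))) => [/dep_proj/andP[]|x]; rewrite ?ffunE.
  by move=> t tT; rewrite ffunE fQ ?Q1P // (eqP (gd t tT)).
have pathn b : path p b n = cst b.
  by apply/ffunP => w; rewrite !ffunE ltn_ord.
have good0 b : good b 0.
  apply/allP => t _; rewrite -hphi ffunE (_ : path p b 0 = p) //.
  by apply/ffunP => w; rewrite ffunE.
have [/andP[gT gF]|] := boolP (good true n && good false n).
  apply: (@identifiable_single _ _ _ phi) => f [[rf _] fQ].
  have fT := goodP f true n rf fQ (leqnn n) gT.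
  have fF := goodP f false n rf fQ (leqnn n) gF.
  rewrite !pathn in fT fF; apply/ffunP => x; case: (rf) => D /ro_mono mf.
  apply/idP/idP => [fx|].
    rewrite -fT ffunE; apply: mf fx => a xa; rewrite !ffunE.
    by case: ifP.
  by rewrite -fF ffunE; apply: mf => a; rewrite !ffunE; case: ifP.
rewrite negb_and => ngood.
have [b ngb] : exists b, ~~ good b n by case/orP: ngood; [exists true|exists false].
have [i [lti gi ngi]] : exists i, [/\ i < n, good b i & ~~ good b i.+1].
  have: forall k, k <= n -> ~~ good b k ->
      exists i, [/\ i < n, good b i & ~~ good b i.+1]; last by move/(_ n (leqnn n) ngb).
  elim=> [_|k IHk lek ngk]; first by rewrite good0.
  have [gk|ngk'] := boolP (good b k); first by exists k.
  exact: IHk (ltnW lek) ngk'.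
pose v := Ordinal lti; pose p' := path p b i.
have pS : path p b i.+1 = upd p' v b by apply: pathS.
have vS : v \notin S.
  apply/negP => vS; case/negP: ngi; apply/allP => t tT; rewrite /= pS.
  have -> : mix S t (upd p' v b) = mix S t p'; last by apply: (allP gi).
  by apply/ffunP => w; rewrite !ffunE; case: (w =P v) => [->|]; rewrite ?vS.
pose c := ~~ b.
have p'v : p' v = c.
  apply: negb_neq => p'v; case/negP: ngi; rewrite /good pS -p'v upd_id; exact: gi.
pose S' := (v |: S)%SET.
have psi_c f x : bproj f S' p' (upd x v c) = bproj f S p' x.
  by rewrite !ffunE mix_upd_out // -p'v upd_id.
have psi_b f x : bproj f S' p' (upd x v b) = f (mix S x (path p b i.+1)).
  by rewrite ffunE mix_upd_out // pS.
pose Q2 := [seq mix S' x p' | x <- probes l v phi].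
have sQ2 : size Q2 = n ^ l.+1 * 2 ^ l.+1 * 2 by rewrite size_map size_probes card_ord.
rewrite /ext_cost -sQ2 -addnA; apply: identifiable_seq => h2 _.
pose Cd := cands v c phi S (bproj h2 S' p').
have sCd : #|Cd| <= #|signature l V| by apply: card_cands => a; rewrite dphi.
pose E := separators Cd; pose Q3 := [seq mix S' x p' | x <- E].
apply: (@identifiable_leq _ (size Q3 + m * step_cost)).
  by rewrite size_map size_separators leq_add2r leq_sqr.
apply: identifiable_seq => h3 [[[rh3 _] h3Q1] h3Q2].
pose psi := bproj h3 S' p'.
have dep_bproj f A q a : dep (bproj f A q) a -> a \in A.
  rewrite (dep_ext (f' := proj f A q)) => [/dep_proj/andP[]//|x]; exact: ffunE.
have phi_p' f : ro_class R l f -> {in Q1, f =1 h} -> bproj f S p' = phi.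
  by move=> rf fQ1; apply: goodP => //; apply: ltnW.
have inCd f : ro_class R l f -> {in Q1, f =1 h} -> {in Q2, f =1 h2} ->
    bproj f S' p' \in Cd.
  move=> rf fQ1 fQ2; rewrite finset.in_set; apply/asboolP; split.
  - exact: ro_bproj.
  - by move=> x; rewrite psi_c phi_p'.
  - by move=> a /dep_bproj.
  - by move=> x xP; rewrite !ffunE fQ2 //; apply: map_f.
have psiCd : psi \in Cd by apply: inCd.
have psi_phi x : psi (upd x v c) = phi x by rewrite psi_c phi_p'.
have dpsi a : dep psi a = (a \in S').
  apply/idP/idP; first exact: dep_bproj.
  rewrite in_setU1 => /predU1P[->|aS].
    have /allPn[t tT /eqP ne] := ngi.
    apply: (@depI _ _ _ t b c); rewrite psi_phi psi_b h3Q1 ?Q1P //; exact/eqP.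
  have nav : a != v by apply: contraNneq vS => <-.
  move: aS; rewrite -dphi => /existsP[x].
  by rewrite -!psi_phi !(updC _ _ _ nav) => /depI.
pose T' := [seq upd t v c | t <- T] ++ probes l v phi ++ E.
have tT' : teaches S' T' psi.
  move=> chi rchi dchi agr.
  have chi_phi : [ffun x => chi (upd x v c)] = phi.
    apply: teach; first exact: ro_restrict.
      move=> a /existsP[x]; rewrite !ffunE; have [->|nav] := eqVneq a v.
        by rewrite !upd_upd eqxx.
      rewrite !(updC _ _ _ nav) => /depI /dchi.
      by rewrite in_setU1 (negbTE nav).
    move=> t tT; rewrite ffunE -psi_phi; apply: agr.
    by rewrite mem_cat; apply/orP; left; apply: map_f.
  apply: (@separatorsP Cd) => //; last first.
    by move=> x xE; apply: agr; rewrite !mem_cat xE !orbT.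
  rewrite finset.in_set; apply/asboolP; split=> //.
    by move=> x; rewrite -[in RHS]chi_phi ffunE.
  move=> x xP; rewrite agr; last by rewrite !mem_cat xP orbT.
  by move: psiCd; rewrite finset.in_set => /asboolP[_ _ _ ->].
apply: identifiable_sub (IH S' p' psi T' _ _ dpsi tT' _) => //.
- move=> f [[[[rf _] fQ1] fQ2] fQ3]; split=> //.
  apply: (@separatorsP Cd) => //; first exact: inCd.
  by move=> x xE; rewrite !ffunE fQ3 //; apply: map_f.
- by rewrite cardsU1 vS; lia.
- exact: ro_bproj.
- have sP : size (probes l v phi) = n ^ l.+1 * 2 ^ l.+1 * 2.
    by rewrite size_probes card_ord.
  have sE : size E <= #|signature l V| ^ 2 by rewrite size_separators leq_sqr.
  rewrite !size_cat size_map sP cardsU1 vS mulSn -addnA addnC.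
  by rewrite leq_add // /ext_cost leq_add2l.
Qed.

Lemma identifiable_ro : identifiable (n.+1 * step_cost).+1 (fun f => ro_class R l f).
Proof.
pose x0 : assignment V := cst false.
apply: (@identifiable_seq _ [:: x0]) => h rh.
pose phi : bfun V := [ffun=> h x0].
have nphi a : ~~ dep phi a by apply: const_indep => x y; rewrite !ffunE.
apply: identifiable_sub (@identifiable_step n finset.set0 x0 phi [:: x0] _ _ _ _ _).
- by rewrite leq_mul2r leqnSn orbT.
- move=> f [rf fx0]; split=> //; apply/ffunP => x; rewrite !ffunE -fx0 ?inE //.
  by congr (f _); apply/ffunP => w; rewrite !ffunE inE.
- by rewrite cards0 subn0.
- by exists finset.set0; apply: (@ro_const _ _ _ _ _ (h x0)) => x; rewrite ffunE.
- by move=> a; rewrite inE (negbTE (nphi a)).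
- move=> psi _ dpsi e; apply/ffunP => x; have := e x0; rewrite inE eqxx => /(_ isT).
  rewrite !ffunE => <-; apply: eq_dep => a /dpsi; by rewrite inE.
- by rewrite addn1.
Qed.

End Learning.

Section PolynomialBound.
Variable R : realType.
Local Open Scope ring_scope.

Definition polynomial_in (F : nat -> nat) :=
  exists P : {poly R}, forall n, (F n)%:R = P.[n%:R].

Lemma polynomial_cst k : polynomial_in (fun=> k).
Proof. by exists (k%:R)%:P => n; rewrite hornerC. Qed.

Lemma polynomial_id : polynomial_in id.
Proof. by exists 'X => n; rewrite hornerX. Qed.

Lemma polynomialD F G : polynomial_in F -> polynomial_in G ->
  polynomial_in (fun n => F n + G n)%N.
Proof. by move=> [P HP] [Q HQ]; exists (P + Q) => n; rewrite natrD HP HQ hornerD. Qed.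

Lemma polynomialM F G : polynomial_in F -> polynomial_in G ->
  polynomial_in (fun n => F n * G n)%N.
Proof. by move=> [P HP] [Q HQ]; exists (P * Q) => n; rewrite natrM HP HQ hornerM. Qed.

Lemma polynomialX F k : polynomial_in F -> polynomial_in (fun n => F n ^ k)%N.
Proof. by move=> [P HP]; exists (P ^+ k) => n; rewrite natrX HP horner_exp. Qed.

Lemma polynomialS F : polynomial_in F -> polynomial_in (fun n => (F n).+1).
Proof.
by case=> P HP; exists (P + 1) => n; rewrite -addn1 natrD HP hornerD hornerC.
Qed.

Lemma polynomial_cost l : polynomial_in (fun n => (n.+1 * step_cost l n).+1).
Proof.
have pext : polynomial_in (ext_cost l).
  have [P HP] : polynomial_in (fun n => n ^ l.+1 * 2 ^ l.+1 * 2 +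
      (8 * (2 ^ l * 2 ^ (2 * 2 ^ l) * n ^ l).+1) ^ 2)%N.
    by repeat first [exact: polynomial_id|exact: polynomial_cst|apply: polynomialD|
      apply: polynomialX|apply: polynomialM|apply: polynomialS].
  by exists P => n; rewrite -HP /ext_cost card_signature card_ord.
apply/polynomialS/polynomialM; first by apply/polynomialS/polynomial_id.
apply: (polynomialD _ pext); apply: polynomialM.
  apply: polynomialM; first exact: polynomial_cst.
  exact/polynomialS/polynomial_id.
apply: polynomialD; last exact: polynomial_cst.
exact: (polynomialM polynomial_id pext).
Qed.

End PolynomialBound.

Lemma finite_basis_arity (B : set gate) : finite_set B ->
  exists l, forall g, B g -> projT1 g <= l.
Proof.
move=> /(finite_image (fun g => projT1 g))/finite_seqP[s sE].
exists (\max_(m <- s) m) => g Bg.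
have : [set` s]%classic (projT1 g) by rewrite -sE; exists g.
by move=> /= gs; apply: leq_bigmax_seq.
Qed.

Lemma finite_basis_identifiable (R : realType) (B : set gate) : finite_set B ->
  (B `<=` monotone_threshold_basis R)%classic ->
  exists P : {poly R}, forall n : nat, exists A : algorithm 'I_n,
    exactly_identifies A (read_once 'I_n B) /\
    ((worst_case_queries A (read_once 'I_n B))%:R <= P.[n%:R])%R.
Proof.
move=> /finite_basis_arity[l Bl] Bmt; have [P HP] := polynomial_cost R l.
exists P => n; have [A HA] := identifiable_ro R l n.
have C_ro (f : bfun 'I_n) : read_once 'I_n B f -> ro_class R l f.
  case=> F [oF rF fE]; exists (leaves F).
  rewrite (_ : (f : assignment 'I_n -> bool) = eval F); last exact/funext.
  exact: formula_ro Bmt Bl F oF rF.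
exists A; split=> [f /C_ro/HA[]//|].
rewrite -HP ler_nat; apply/bigmax_leqP => f /asboolP/C_ro/HA[_]; exact.
Qed.

(** * The exponential lower bound *)

Section LowerBound.
Variables (R : realType) (n : nat).
Local Notation V := 'I_n.
Implicit Types (S : {set V}) (x : assignment V) (k : nat).

Definition support x : {set V} := finset (fun i => x i).

Definition above k : bfun V := [ffun x => k < #|support x|].

Definition spike k S : bfun V := [ffun x => (k < #|support x|) || (support x == S)].

Lemma monotone_threshold_read_once (f : bfun V) :
  monotone_threshold R f -> read_once V (monotone_threshold_basis R) f.
Proof.
move=> mt; exists (App (g := existT _ n f) (fun i => Var i)); split.
- by split.
- move=> v /=; rewrite (bigD1 v) //= eqxx big1 // => i; rewrite eq_sym.
  by move/negbTE->.
- by move=> x /=; congr (f _); apply/ffunP => i; rewrite ffunE.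
Qed.

Lemma sum_support x (F : V -> nat) :
  (\sum_i (F i)%:R * (x i)%:R = (\sum_(i in support x) F i)%:R :> R)%R.
Proof.
rewrite natr_sum [RHS]big_mkcond; apply: eq_bigr => i _.
by rewrite inE; case: (x i); rewrite ?mulr1 ?mulr0.
Qed.

Lemma above_threshold k : monotone_threshold R (above k).
Proof.
exists (k.+1%:R)%R, (fun=> 1%:R)%R; split=> [i|x]; first exact: ler01.
by rewrite ffunE (sum_support x (fun=> 1)) sum1_card ler_nat.
Qed.

Lemma spike_threshold k S : #|S| = k -> monotone_threshold R (spike k S).
Proof.
move=> cS; exists ((k * k.+1)%:R)%R, (fun i => (k + (i \in S))%:R)%R.
split=> [i|x]; first exact: ler0n.
rewrite ffunE sum_support ler_nat big_split /= sum_nat_const.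
set X := support x.
have -> : \sum_(i in X) (i \in S) = #|X :&: S|.
  rewrite -sum1_card [RHS]big_mkcond [LHS]big_mkcond; apply: eq_bigr => i _.
  by rewrite finset.in_setI; case: (i \in X); case: (i \in S).
have le1 : #|X :&: S| <= #|X| by rewrite subset_leq_card // finset.subsetIl.
have [->|nXS] := eqVneq X S; first by rewrite finset.setIid cS orbT mulnS addnC leqnn.
rewrite orbF; apply/idP/idP => [lt|h].
  by rewrite mulnC (leq_trans _ (leq_addr _ _)) // leq_mul2r lt orbT.
rewrite ltnNge; apply/negP => leXk.
have eX : #|X| = k.
  apply/eqP; rewrite eqn_leq leXk -(leq_pmul2r (ltn0Sn k)) (leq_trans h) //.
  by rewrite [leqRHS]mulnS addnC leq_add2r.
have eXS : #|X :&: S| = k.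
  apply/eqP; rewrite eqn_leq -{1}eX le1 /=.
  by move: h; rewrite eX mulnS addnC leq_add2l.
case/negP: nXS; rewrite -(_ : X :&: S = X); last first.
  by apply/eqP; rewrite eqEcard finset.subsetIl eX eXS leqnn.
by rewrite eqEcard finset.subsetIr eXS cS leqnn.
Qed.

Lemma monotone_threshold_mono (f : bfun V) : monotone_threshold R f -> mono f.
Proof.
case=> a0 [a [a_ge0 fE]] x y xy; rewrite !fE => /le_trans; apply.
apply: ler_sum => i _; rewrite ler_wpM2l // ler_nat.
by have := xy i; case: (x i) => // ->.
Qed.

Lemma mono_subcube (f : bfun V) (p : partial_assignment V) : mono f ->
  answer f (SubcubeIdentity p) = ~~ f (fill (p := p) (cst true)) || f (fill (p := p) (cst false)).
Proof.
move=> mf /=; have fillm (y y' : assignment (free_var p)) : (forall u, y u -> y' u) ->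
    forall v, fill (p := p) y v -> fill y' v.
  by move=> yy v; rewrite !ffunE; case: insub => // u; apply: yy.
congr orb.
  apply/forallP/idP => [/(_ (cst true))|nf y]; first by rewrite ffunE => /eqP ->.
  rewrite ffunE; apply: contraNT nf; rewrite eqbF_neg negbK.
  by apply: mf; apply: fillm => u; rewrite [cst _ _]ffunE.
apply/forallP/idP => [/(_ (cst false))|nf y]; first by rewrite ffunE => /eqP ->.
rewrite ffunE eqb_id; apply: mf nf; apply: fillm => u; by rewrite ffunE.
Qed.

Lemma spike_answers k (q : query V) : exists2 D : {set {set V}}, #|D| <= 2 &
  forall S, #|S| = k -> S \notin D -> answer (spike k S) q = answer (above k) q.
Proof.
have sE x S : support x != S -> spike k S x = above k x.
  by move=> /negbTE nS; rewrite !ffunE nS orbF.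
case: q => [a|p].
  exists [set support a]%SET; first by rewrite cards1.
  by move=> S _; rewrite inE eq_sym => /sE.
exists [set support (fill (p := p) (cst true)); support (fill (p := p) (cst false))]%SET.
  by rewrite cards2; case: eqP.
move=> S cS; rewrite !inE negb_or => /andP[n1 n2].
have ma := monotone_threshold_mono (above_threshold k).
have ms := monotone_threshold_mono (spike_threshold cS).
by rewrite !mono_subcube // !sE // eq_sym.
Qed.

Lemma spike_run k (A : algorithm V) : exists2 D : {set {set V}},
  #|D| <= 2 * queries_used A (above k) &
  forall S, #|S| = k -> S \notin D -> run A (spike k S) = run A (above k).
Proof.
elim: A => [f|q no IHno yes IHyes] /=; first by exists finset.set0; rewrite ?cards0.
have [D0 cD0 D0P] := spike_answers k q.
have [D1 cD1 D1P] : exists2 D : {set {set V}},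
    #|D| <= 2 * queries_used (if answer (above k) q then yes else no) (above k) &
    forall S, #|S| = k -> S \notin D ->
      run (if answer (above k) q then yes else no) (spike k S) =
      run (if answer (above k) q then yes else no) (above k).
  by case: ifP.
exists (D0 :|: D1)%SET.
  by rewrite mulnS (leq_trans (leq_card_setU _ _)) // leq_add.
move=> S cS; rewrite inE negb_or => /andP[nS0 nS1].
by rewrite D0P // D1P.
Qed.

Lemma spike_bound k (A : algorithm V) :
  exactly_identifies A (read_once V (monotone_threshold_basis R)) ->
  'C(n, k) <= 2 * worst_case_queries A (read_once V (monotone_threshold_basis R)).
Proof.
move=> AC; have [D cD DP] := spike_run k A.
have ro_above : read_once V (monotone_threshold_basis R) (above k).
  exact/monotone_threshold_read_once/above_threshold.
apply: (@leq_trans #|D|); last first.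
  apply: (leq_trans cD); rewrite leq_mul2l /=.
  by apply: (leq_bigmax_cond (P := fun f => `[< _ f >])); apply/asboolP.
rewrite -[X in 'C(X, k)](card_ord n) -card_draws; apply: subset_leq_card.
apply/fintype.subsetP => S; rewrite inE => /eqP cS; apply/negPn/negP => /(DP S cS).
rewrite !AC //; last exact/monotone_threshold_read_once/spike_threshold.
move/ffunP/(_ [ffun i => i \in S]); rewrite !ffunE.
have -> : support [ffun i => i \in S] = S by apply/setP => i; rewrite inE ffunE.
by rewrite cS ltnn eqxx.
Qed.

End LowerBound.

Lemma exp2_bin k m : 2 * k <= m -> 2 ^ k <= 'C(m, k).
Proof.
elim: k m => [|k IH] [|m] le2; rewrite ?bin0 //.
rewrite -(leq_pmul2l (ltn0Sn k)) -mul_bin_diag expnS mulnA.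
by apply: leq_mul; [lia|apply: IH; lia].
Qed.

Lemma exp_growth (R : realType) k :
  ((5%:R / 4%:R) ^+ (2 * (k + 4) + 1) <= 2%:R ^+ (k + 3) :> R)%R.
Proof.
elim: k => [|k IH].
  rewrite !add0n (_ : 2 * 4 + 1 = 9) // !exprS expr0; lra.
rewrite (_ : 2 * (k.+1 + 4) + 1 = (2 * (k + 4) + 1) + 2); last by lia.
rewrite addSn exprSr exprD; apply: ler_pM => //.
- by apply: exprn_ge0; lra.
- by apply: exprn_ge0; lra.
- by rewrite !exprS expr0; lra.
Qed.

Local Open Scope classical_set_scope.
Local Open Scope ring_scope.

Theorem theorem4 (R : realType) :
  (exists (c : R) (n0 : nat), 1 < c /\
     forall n : nat, (n0 <= n)%N -> forall A : algorithm 'I_n,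
       exactly_identifies A (read_once 'I_n (monotone_threshold_basis R)) ->
       c ^+ n <=
         (worst_case_queries A (read_once 'I_n (monotone_threshold_basis R)))%:R)
  /\
  (forall B : set gate, finite_set B -> B `<=` monotone_threshold_basis R ->
     exists P : {poly R}, forall n : nat, exists A : algorithm 'I_n,
       exactly_identifies A (read_once 'I_n B) /\
       (worst_case_queries A (read_once 'I_n B))%:R <= P.[n%:R]).
Proof.
split; last by move=> B; apply: finite_basis_identifiable.
exists (5%:R / 4%:R), 8%N; split=> [|n n8 A HA]; first by lra.
have [k [k4n nk4]] : exists k, (2 * (k + 4) <= n)%N /\ (n <= 2 * (k + 4) + 1)%N.
  by exists (n./2 - 4)%N; lia.
apply: (@le_trans _ _ ((5%:R / 4%:R) ^+ (2 * (k + 4) + 1))).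
  by apply: ler_weXn2l => //; lra.
apply: (le_trans (exp_growth R k)); rewrite -natrX ler_nat.
have := leq_trans (exp2_bin k4n) (spike_bound (k + 4)%N HA).
by rewrite (addnS k 3) expnS leq_pmul2l.
Qed.
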